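(* Let $G \rightrightarrows M$ be a Lie groupoid with source $s : G \to M$, target $t : G \to M$ and Lie algebroid $A \Rightarrow M$. Then $G$ integrates a Nijenhuis operator $\mathcal N$ on $M$ if and only if there exists a vector bundle map $U : TM \to A$ (over $\mathrm{id}_M$) such that: 1) $\ker \overrightarrow U = \ker dt$; 2) $\operatorname{im} \overrightarrow U = \ker ds$; and 3) $[\overrightarrow U, \overrightarrow U]^{\mathrm{fn}} = 0$, i.e. $\overrightarrow U$ is a Nijenhuis operator on $G$.
   Context: A Nijenhuis operator on a manifold $P$ is a $(1,1)$ tensor $\mathcal N : TP \to TP$ whose Nijenhuis torsion $T_{\mathcal N}(X,Y) = [\mathcal NX, \mathcal NY] + \mathcal N^2[X,Y] - \mathcal N[\mathcal NX, Y] - \mathcal N [X, \mathcal NY]$ vanishes; equivalently $[\mathcal N,\mathcal N]^{\mathrm{fn}} = 2T_{\mathcal N} = 0$, where $[-,-]^{\mathrm{fn}}$ is the Fr\''olicher-Nijenhuis bracket of vector valued forms. A Nijenhuis operator $\mathcal N$ on $M$ defines a Lie algebroid $(TM)_{\mathcal N} \Rightarrow M$ with underlying vector bundle $TM$, anchor $\mathcal N$ and bracket $[X, Y]_{\mathcal N} = [\mathcal N X, Y] +[X, \mathcal N Y] - \mathcal N[X,Y]$. The Lie algebroid of $G$ is $A = \ker ds|_M$ (restriction to the units), with anchor $\rho_A = dt|_A$ and bracket defined via right invariant vector fields. A Lie groupoid $G \rightrightarrows M$ with Lie algebroid $A$ integrates a Nijenhuis operator $\mathcal N$ on $M$ if there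 exists a Lie algebroid isomorphism $A \cong (TM)_{\mathcal N}$. For a vector bundle map $U : TM \to A$, $\overrightarrow U$ is the $(1,1)$ tensor on $G$ defined by $\overrightarrow U_g = dR_g \circ U_{t(g)} \circ dt$ for all $g \in G$, where $R_g : s^{-1}(t(g)) \to s^{-1}(s(g))$, $h \mapsto hg$, is right translation. *)

(* Defs.v *)
From mathcomp Require Export all_boot all_order all_algebra.
From mathcomp Require Export all_classical all_reals all_analysis.
Set Implicit Arguments.
Unset Strict Implicit.
Unset Printing Implicit Defensive.
Export Order.TTheory GRing.Theory Num.Theory.
Export numFieldNormedType.Exports.
Local Open Scope classical_set_scope.
Local Open Scope ring_scope.

(* Below, the set [V] (or [U], [W], [O]) on which smoothness is asserted is
   always an open set; the values of the function off that set are
   irrelevant. *)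
Fixpoint Ck {R : realType} {n : nat} (k : nat) (U : set 'rV[R]_n)
    (f : 'rV[R]_n -> R) : Prop :=
  (forall x, U x -> {for x, continuous f}) /\
  if k is k'.+1 then
    forall v, (forall x, U x -> derivable f x v) /\ Ck k' U (fun x => 'D_v f x)
  else True.

Definition smooth_in {R : realType} {n : nat} (U : set 'rV[R]_n)
    (f : 'rV[R]_n -> R) : Prop :=
  forall k, Ck k U f.

Definition smooth_in_rV {R : realType} {n l : nat} (U : set 'rV[R]_n)
    (f : 'rV[R]_n -> 'rV[R]_l) : Prop :=
  forall i, smooth_in U (fun x => f x 0 i).

Record chart (R : realType) (T : topologicalType) (n : nat) := Chart {
  cdom : set T;
  cmap : T -> 'rV[R]_n;
  cinv : 'rV[R]_n -> T;
  cdom_open : open cdom;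
  ccod_open : open (cmap @` cdom);
  cmapK : {in cdom, cancel cmap cinv};
  cmap_continuous : forall x, cdom x -> {for x, continuous cmap};
  cinv_continuous : forall y, (cmap @` cdom) y -> {for y, continuous cinv}
}.

Record manifold (R : realType) (n : nat) := Manifold {
  mspace :> topologicalType;
  atlas : set (chart R mspace n);
  atlas_cover : forall p : mspace, exists2 c, atlas c & cdom c p;
  atlas_compatible : forall c d, atlas c -> atlas d ->
    smooth_in_rV (cmap c @` (cdom c `&` cdom d)) (cmap d \o cinv c);
  manifold_hausdorff : hausdorff_space mspace;
  manifold_second_countable : @second_countable mspace
}.

Section Smooth.
Context {R : realType} {m n : nat} {M : manifold R m} {N : manifold R n}.

Definition smooth_on (V : set M) (f : M -> R) : Prop :=
  forall c, atlas c -> smooth_in (cmap c @` (cdom c `&` V)) (f \o cinv c).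

Definition smooth_at (p : M) (f : M -> R) : Prop :=
  exists V, [/\ open V, V p & smooth_on V f].

Definition smooth_map (F : M -> N) : Prop :=
  continuous F /\
  forall c d, atlas c -> atlas d ->
    smooth_in_rV (cmap c @` (cdom c `&` F @^-1` cdom d))
                 (cmap d \o F \o cinv c).

End Smooth.

(* A tangent vector at [p] is the directional derivative,
    along some [a] in R^m and in some chart around [p], acting on the functions
    that are smooth near [p].  It is extended by 0 to the other functions, so
    that tangent vectors are equal as soon as they agree on smooth functions;
    the vector space operations are the pointwise ones. *)

Notation functional R M := ((M -> R) -> R).

Section Tangent.
Context {R : realType} {m : nat} {M : manifold R m}.

Definition chart_derivation (c : chart R M m) (p : M) (a : 'rV[R]_m)
    : functional R M :=
  fun f => if `[< smooth_at p f >] then 'D_a (f \o cinv c) (cmap c p) else 0.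

Definition tangent (p : M) : set (functional R M) :=
  [set v | exists c a,
    [/\ atlas c, cdom c p & v = chart_derivation c p a]].

End Tangent.

Section Differential.
Context {R : realType} {m n : nat} {M : manifold R m} {N : manifold R n}.

Definition dmap (F : M -> N) (p : M) (v : functional R M) : functional R N :=
  fun f => if `[< smooth_at (F p) f >] then v (f \o F) else 0.

(* The differential at [p] of a map [F] defined and smooth only on a
   submanifold [S] of [M], applied to a vector [v] tangent to [S]: smooth
   functions on [S] are locally restrictions of smooth functions [e] on [M],
   and [v e] does not depend on the choice of the extension [e]. *)
Definition dmap_within (S : set M) (F : M -> N) (p : M) (v : functional R M)
    : functional R N :=
  fun f =>
    if `[< smooth_at (F p) f >] then
      v (xget (cst 0) [set e | smooth_at p e /\
                               \forall q \near p, S q -> e q = f (F q)])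
    else 0.

Definition submersion (F : M -> N) : Prop :=
  smooth_map F /\
  forall p w, tangent (F p) w -> exists2 v, tangent p v & dmap F p v = w.

(* Smooth sections over [V] of the pull-back of TN along [u : M -> N]. *)
Definition smooth_along (u : M -> N) (V : set M) (X : M -> functional R N)
    : Prop :=
  (forall x, V x -> tangent (u x) (X x)) /\
  forall (O : set N) f, open O -> smooth_on O f ->
    smooth_on (V `&` u @^-1` O) (fun x => X x f).

End Differential.

Section Bundles.
Context {R : realType} {m : nat} {M : manifold R m}.

(* A vector bundle over [M] is presented by its fibers, as linear subspaces of
   one ambient space, and its smooth sections over the open sets of [M]. *)
Record bundle := Bundle {
  bspace : lmodType R;
  bfiber : M -> set bspace;
  bsection : set M -> set (M -> bspace)
}.
Arguments bfiber : clear implicits.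
Arguments bsection : clear implicits.

Definition bundle_map (E F : bundle) (U : M -> bspace E -> bspace F) : Prop :=
  [/\ forall x v, bfiber E x v -> bfiber F x (U x v),
      forall x (a : R) v w, bfiber E x v -> bfiber E x w ->
        U x (a *: v + w) = a *: U x v + U x w
    & forall V s, open V -> bsection E V s ->
        bsection F V (fun x => U x (s x))].

Definition bundle_iso (E F : bundle) (U : M -> bspace E -> bspace F) : Prop :=
  bundle_map U /\
  exists U' : M -> bspace F -> bspace E,
    [/\ bundle_map U',
        forall x v, bfiber E x v -> U' x (U x v) = v
      & forall x w, bfiber F x w -> U x (U' x w) = w].

End Bundles.
Arguments bundle {R m} M.
Arguments bfiber {R m M}.
Arguments bsection {R m M}.

Section Nijenhuis.
Context {R : realType} {m : nat} {M : manifold R m}.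
Implicit Types (K L N : M -> functional R M -> functional R M).
Implicit Types (X Y : M -> functional R M).

Definition vector_field (V : set M) X : Prop := smooth_along id V X.

Definition tangent_bundle : bundle M :=
  @Bundle R m M (functional R M) tangent vector_field.

Definition lie_bracket X Y : M -> functional R M :=
  fun p f => if `[< smooth_at p f >]
             then X p (fun q => Y q f) - Y p (fun q => X q f) else 0.

Definition tensor11 N : Prop := @bundle_map R m M tangent_bundle tangent_bundle N.

Definition tapp N X : M -> functional R M := fun p => N p (X p).

Definition torsion N X Y : M -> functional R M := fun p =>
  lie_bracket (tapp N X) (tapp N Y) p
  + N p (N p (lie_bracket X Y p))
  - N p (lie_bracket (tapp N X) Y p)
  - N p (lie_bracket X (tapp N Y) p).

(* Vanishing is tested on vector fields over arbitrary open sets, which is the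
   same as on global ones since the torsion is tensorial. *)
Definition nijenhuis N : Prop :=
  tensor11 N /\
  forall V X Y, open V -> vector_field V X -> vector_field V Y ->
    forall p, V p -> torsion N X Y p = 0.

(* The Froelicher-Nijenhuis bracket of two vector valued 1-forms, a vector
   valued 2-form, evaluated on vector fields (see Kolar, Michor and Slovak,
   Natural Operations in Differential Geometry, section 8); for K = L it is
   twice the torsion. *)
Definition fn_bracket K L X Y : M -> functional R M := fun p =>
  lie_bracket (tapp K X) (tapp L Y) p - lie_bracket (tapp K Y) (tapp L X) p
  - L p (lie_bracket (tapp K X) Y p - lie_bracket (tapp K Y) X p)
  - K p (lie_bracket (tapp L X) Y p - lie_bracket (tapp L Y) X p)
  + (L p (K p (lie_bracket X Y p)) + K p (L p (lie_bracket X Y p))).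

Definition fn_bracket_eq0 K L : Prop :=
  forall V X Y, open V -> vector_field V X -> vector_field V Y ->
    forall p, V p -> fn_bracket K L X Y p = 0.

End Nijenhuis.
Arguments tangent_bundle {R m} M.

(* Only the data of a Lie algebroid over [M] is recorded: that the two
    algebroids below satisfy the Lie algebroid axioms (when [N] is Nijenhuis)
    is not needed to say what an isomorphism between them is. *)

Record algebroid (R : realType) (m : nat) (M : manifold R m) := Algebroid {
  abundle :> bundle M;
  anchor : M -> bspace abundle -> functional R M;
  abracket : (M -> bspace abundle) -> (M -> bspace abundle) ->
             (M -> bspace abundle)
}.
Arguments anchor {R m M}.
Arguments abracket {R m M}.

Definition algebroid_iso {R : realType} {m : nat} {M : manifold R m}
    (A B : algebroid M) (F : M -> bspace A -> bspace B) : Prop :=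
  [/\ bundle_iso F,
      forall x v, bfiber A x v -> anchor B x (F x v) = anchor A x v
    & forall V a b, open V -> bsection A V a -> bsection A V b ->
        forall x, V x ->
          F x (abracket A a b x) =
          abracket B (fun y => F y (a y)) (fun y => F y (b y)) x].

Definition nijenhuis_algebroid {R : realType} {m : nat} {M : manifold R m}
    (N : M -> functional R M -> functional R M) : algebroid M :=
  @Algebroid R m M (tangent_bundle M) N
    (fun X Y p => lie_bracket (tapp N X) Y p + lie_bracket X (tapp N Y) p
                  - N p (lie_bracket X Y p)).

(* In a Lie groupoid, the product [gmul g h] is meaningful when
    [src g = tgt h]; its other values are irrelevant. *)

(* A map defined on a subset [S] of [G * G] (here the submanifold of composable
   pairs) is smooth when it locally extends, in charts, to a smooth map. *)
Definition smooth_on_pairs {R : realType} {k : nat} {G : manifold R k}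
    (S : G -> G -> Prop) (mul : G -> G -> G) : Prop :=
  forall g h, S g h ->
  exists a b c (W : set 'rV[R]_(k + k)) (F : 'rV[R]_(k + k) -> 'rV[R]_k),
    [/\ [/\ atlas a, atlas b & atlas c],
        cdom a g /\ cdom b h,
        open W /\ W (row_mx (cmap a g) (cmap b h)),
        smooth_in_rV W F
      & forall g' h', cdom a g' -> cdom b h' -> S g' h' ->
          W (row_mx (cmap a g') (cmap b h')) ->
          cdom c (mul g' h') /\
          cmap c (mul g' h') = F (row_mx (cmap a g') (cmap b h'))].

Record lie_groupoid (R : realType) (k m : nat) (G : manifold R k)
    (M : manifold R m) := LieGroupoid {
  src : G -> M;
  tgt : G -> M;
  gunit : M -> G;
  ginv : G -> G;
  gmul : G -> G -> G;
  src_mul : forall g h, src g = tgt h -> src (gmul g h) = src h;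
  tgt_mul : forall g h, src g = tgt h -> tgt (gmul g h) = tgt g;
  gmulA : forall g h l, src g = tgt h -> src h = tgt l ->
    gmul g (gmul h l) = gmul (gmul g h) l;
  src_unit : forall x, src (gunit x) = x;
  tgt_unit : forall x, tgt (gunit x) = x;
  gmul1g : forall g, gmul (gunit (tgt g)) g = g;
  gmulg1 : forall g, gmul g (gunit (src g)) = g;
  src_inv : forall g, src (ginv g) = tgt g;
  tgt_inv : forall g, tgt (ginv g) = src g;
  gmulVg : forall g, gmul (ginv g) g = gunit (src g);
  gmulgV : forall g, gmul g (ginv g) = gunit (tgt g);
  src_submersion : submersion src;
  tgt_submersion : submersion tgt;
  gunit_smooth : smooth_map gunit;
  ginv_smooth : smooth_map ginv;
  gmul_smooth : smooth_on_pairs (fun g h => src g = tgt h) gmul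
}.

Section Groupoid.
Context {R : realType} {k m : nat} {G : manifold R k} {M : manifold R m}.
Variable GM : lie_groupoid G M.

(* The differential at [h], where [src h = tgt g], of the right translation
   [R_g : s^-1(t(g)) -> s^-1(s(g))], on the vectors in [ker ds]. *)
Definition dright (g h : G) : functional R G -> functional R G :=
  dmap_within [set l | src GM l = tgt GM g] (fun l => gmul GM l g) h.

(* A = (ker ds) restricted to the units *)
Definition groupoid_bundle : bundle M :=
  @Bundle R m M (functional R G)
    (fun x => [set v | tangent (gunit GM x) v /\
                       dmap (src GM) (gunit GM x) v = 0])
    (fun V => [set a | smooth_along (gunit GM) V a /\
                       forall x, V x -> dmap (src GM) (gunit GM x) (a x) = 0]).

Definition right_invariant (a : M -> functional R G) : G -> functional R G :=
  fun g => dright g (gunit GM (tgt GM g)) (a (tgt GM g)).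

Definition groupoid_algebroid : algebroid M :=
  @Algebroid R m M groupoid_bundle
    (fun x => dmap (tgt GM) (gunit GM x))
    (fun a b x =>
       lie_bracket (right_invariant a) (right_invariant b) (gunit GM x)).

Definition integrates (N : M -> functional R M -> functional R M) : Prop :=
  exists F, @algebroid_iso R m M groupoid_algebroid (nijenhuis_algebroid N) F.

Definition right_tensor (U : M -> functional R M -> functional R G)
    : G -> functional R G -> functional R G :=
  fun g v => dright g (gunit GM (tgt GM g)) (U (tgt GM g) (dmap (tgt GM) g v)).

End Groupoid.

(* Main.v *)
From HB Require Import structures.
Require Import Defs.
From mathcomp Require Import ring lra.
Set Implicit Arguments.
Unset Strict Implicit.
Unset Printing Implicit Defensive.
Local Open Scope classical_set_scope.
Local Open Scope ring_scope.

(* In a chart x of M around t(g), put t^i = x^i o t, let B_i be the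
   right-invariant vector field of U d_i, and let N = rho o U, of matrix n.
   Since a tangent vector v at g has image sum_i v(t^i) B_i under the
   right-invariant tensor of U, and B_j(t^i) = n_ji o t, the terms of the torsion
   involving derivatives of X(t^i) and Y(t^i) cancel and
     T(X, Y) = sum_lj X(t^l) Y(t^j) S_lj,
     S_lj = [B_l, B_j] - sum_i (d_l n_ji - d_j n_li)(t) B_i.
   The same S_lj, now at the units, are the components of the tensor
   (X, Y) |-> [U X, U Y]_A - U [X, Y]_N on M.  As S_lj is right-invariant, the
   torsion vanishes if and only if U preserves brackets; N is then Nijenhuis
   because the anchor of A preserves brackets too, and the conditions on the
   kernel and the image say that U is an isomorphism onto A.

   The differential of a right translation acts on a vector v of ker ds through
   an extension of a function off a source fiber.  It does not depend on the
   extension because v is tangent to the fiber in the weak sense that some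
   points of the fiber are at distance o(r) of the points reached by v at time
   r, which a contraction argument provides without parametrizing the fiber. *)

(** * Differential calculus in R^n *)

(** The argument uses no local frame of A, no flow and no implicit function theorem. The expansion
    of the torsion holds for arbitrary X and Y on G, and its right-hand side depends on them only
    through the numbers X(t^l) and Y(t^j) at g. To recover S_lj from condition 3 it is therefore
    enough to lift d_l and d_j through the differential of [t] at one unit, and to extend the lifts
    with constant coefficients in a chart of G. Right-invariance of S_lj takes the form that a
    single extension e of f o R_g near the unit serves all l and j at once. In one direction U is
    the inverse of the given isomorphism. In the other the isomorphism is the pointwise inverse of
    U, and the point to prove is that it preserves smoothness of sections: in charts U is a
    rectangular matrix, injective at each point, and Cramer's rule applies to its product with a
    constant matrix. *)

Section Directional.
Context {R : realType} {V : normedModType R}.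
Implicit Types (f : V -> R) (x v : V).

Lemma derive_line f x v : 'D_v f x = 'D_1 (fun t : R => f (t *: v + x)) 0.
Proof.
rewrite /derive; set g1 := fun h => h^-1 *: _; set g2 := fun h => h^-1 *: _.
suff -> : g1 = g2 by [].
by rewrite funeqE /g1 /g2 => h /=; rewrite addr0 scale0r add0r [_%:A]mulr1.
Qed.

Lemma derive_shiftE f a x v : 'D_v (f \o shift a) x = 'D_v f (x + a).
Proof.
rewrite /derive /=; set g1 := fun h => h^-1 *: _; set g2 := fun h => h^-1 *: _.
suff -> : g1 = g2 by [].
by apply/funext => h; rewrite /g1 /g2 /= addrA.
Qed.

Lemma derivable_shiftE f a x v :
  derivable (f \o shift a) x v <-> derivable f (x + a) v.
Proof.
rewrite /derivable /=; set g1 := fun h => h^-1 *: _; set g2 := fun h => h^-1 *: _.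
suff -> : g1 = g2 by [].
by apply/funext => h; rewrite /g1 /g2 /= addrA.
Qed.

End Directional.

Section DirectionalLine.
Context {R : realType} {V : normedModType R}.
Implicit Types (f : V -> R) (x v : V).

Lemma is_derive_line f p v t :
  derivable f (p + t *: v) v ->
  is_derive t 1 (fun t : R => f (p + t *: v)) ('D_v f (p + t *: v)).
Proof.
move=> df; have -> : (fun t : R => f (p + t *: v)) =
    (fun h => f (h *: v + (p + t *: v))) \o shift (- t).
  apply/funext => s /=; congr f.
  by rewrite scalerDl scaleNr addrA addrAC subrK addrC.
split; last by rewrite derive_shiftE subrr -derive_line.
apply/(derivable_shiftE (V := R^o)); rewrite subrr.
by have /derivable1P := df.
Qed.

(** Only derivability along [v] is assumed, so homogeneity cannot be read off a differential; it
    comes from the chain rule for [t * h] on the line through [x]. *)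
Lemma deriveZdir f x v (h : R) : derivable f x v -> 'D_(h *: v) f x = h * 'D_v f x.
Proof.
move=> df; rewrite derive_line.
have -> : (fun t : R => f (t *: (h *: v) + x)) =
   (fun t : R => f (x + t *: v)) \o (fun t => t * h).
  by apply/funext => t /=; rewrite scalerA addrC.
have /= H := @is_derive_line f x v (0 * h).
rewrite mul0r scale0r addr0 in H; have {}H := H df.
have H2 : is_derive (0 : R) 1 (fun t : R => t * h) h.
  have -> : (fun t : R => t * h) = (fun t => h *: id t).
    by apply/funext => t; rewrite /= mulrC.
  by apply: is_derive_eq; rewrite [_ *: _]mulr1.
have H1 : is_derive (0 * h) 1 (fun t : R => f (x + t *: v)) ('D_v f x).
  by rewrite mul0r.
have := @is_derive1_comp _ (fun t : R => f (x + t *: v)) (fun t => t * h) 0 _ _ H1 H2.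
by move=> [_ ->]; rewrite mulrC.
Qed.

Lemma derivableZdir f x v (h : R) : derivable f x v -> derivable f x (h *: v).
Proof.
move=> df; apply/derivable1P.
have -> : (fun t : R => f (t *: (h *: v) + x)) =
   (fun t : R => f (x + t *: v)) \o (fun t => h *: id t).
  by apply/funext => t /=; rewrite scalerA addrC mulrC.
apply/derivable1_diffP; apply: differentiable_comp => //.
apply/derivable1_diffP.
have /= := @is_derive_line f x v 0.
by rewrite scale0r addr0 => /(_ df) [? _]; rewrite /= scaler0.
Qed.

Lemma MVT_dir f p v :
  (forall t : R, 0 <= t <= 1 -> derivable f (p + t *: v) v) ->
  exists2 c : R, 0 <= c <= 1 & f (p + v) - f p = 'D_v f (p + c *: v).
Proof.
move=> df.
have H (t : R) : t \in `[(0 : R), 1]%R -> is_derive t 1 (fun t : R => f (p + t *: v)) ('D_v f (p + t *: v)).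
  by rewrite in_itv /= => t01; apply: is_derive_line; apply: df.
pose g (t : R) := f (p + t *: v); pose dg (t : R) := 'D_v f (p + t *: v).
have dg01 t : t \in `](0 : R), 1[%R -> is_derive t 1 g (dg t).
  by move=> t01; apply: H; apply: subset_itv_oo_cc t01.
have cg : {within `[(0 : R), 1], continuous g}.
  by apply: derivable_within_continuous => t /H [].
have [c c01] := @MVT_segment R g dg 0 1 ler01 dg01 cg; rewrite /g /dg.
rewrite scale1r scale0r addr0 subr0 mulr1 => E; by exists c.
Qed.

End DirectionalLine.

Section RowNorm.
Context {R : realType} {n : nat}.
Implicit Types v : 'rV[R]_n.

Lemma rV_coord_le v i : `|v 0 i| <= `|v|.
Proof.
rewrite -[leRHS]/(mx_norm v) mx_normrE; apply/bigmax_geP; right => /=.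
by exists (0, i).
Qed.

Lemma rV_norm_le v r : 0 <= r -> (forall i, `|v 0 i| <= r) -> `|v| <= r.
Proof.
move=> r0 vr; rewrite -[leLHS]/(mx_norm v) mx_normrE; apply/bigmax_leP; split=> //.
by move=> [i j] _; rewrite ord1.
Qed.

Lemma rV_norm_lt v r : 0 < r -> (forall i, `|v 0 i| < r) -> `|v| < r.
Proof.
move=> r0 vr; rewrite -[ltLHS]/(mx_norm v) mx_normrE; apply/bigmax_ltP; split=> //.
by move=> [i j] _; rewrite ord1.
Qed.

Lemma continuous_rV (T : topologicalType) (g : T -> 'rV[R]_n) x :
  (forall i, {for x, continuous (fun y => g y 0 i)}) -> {for x, continuous g}.
Proof.
move=> gc; apply/cvgrPdist_lt => e e0.
have : \forall y \near x, forall i, `|g x 0 i - g y 0 i| < e.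
  by apply: filter_forall => i; have /cvgrPdist_lt/(_ _ e0) := gc i.
by apply: filterS => y yi; apply: rV_norm_lt => // i; rewrite !mxE.
Qed.

Lemma continuous_ball (g : 'rV[R]_n -> R) (x : 'rV[R]_n) : {for x, continuous g} -> forall e : R, 0 < e ->
  exists2 d : R, 0 < d & forall w : 'rV[R]_n, `|w - x| < d -> `|g w - g x| < e.
Proof.
move=> gc e e0; have /cvgrPdist_lt/(_ _ e0)/nbhs_normP[d /= d0 H] := gc.
by exists d => // w wx; rewrite distrC; apply: H; rewrite /= distrC.
Qed.
Lemma open_ball (U : set 'rV[R]_n) (x : 'rV[R]_n) : open U -> U x ->
  exists2 d : R, 0 < d & forall w : 'rV[R]_n, `|w - x| < d -> U w.
Proof.
move=> oU Ux; have /nbhs_normP[d /= d0 H] : nbhs x U by exact: open_nbhs_nbhs.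
by exists d => // w wx; apply: H; rewrite /= distrC.
Qed.
Lemma exists_min (I : finType) (P : I -> R -> Prop) :
  (forall i, exists2 d : R, 0 < d & forall d', d' <= d -> P i d') ->
  exists2 d : R, 0 < d & forall i, P i d.
Proof.
move=> /(_ _)/cid2-/all_sig2[d d0 H].
(* The initial value 1 keeps the minimum positive when [I] is empty. *)
exists (\big[Order.min/1]_i d i).
  by elim/big_ind : _ => // a b a0 b0; rewrite lt_min a0.
by move=> i; apply: H; rewrite bigmin_le_cond.
Qed.

End RowNorm.

(** * Strict differentiability, symmetry of second derivatives and calculus of C^k functions *)

Section StrictDifferentiability.
Context {R : realType}.

Lemma near_eq_continuous (T : topologicalType) (f g : T -> R) x :
  {near x, f =1 g} -> {for x, continuous f} -> {for x, continuous g}.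
Proof.
move=> fg fc; rewrite /prop_for /continuous_at -(nbhs_singleton fg).
exact: cvg_trans (near_eq_cvg fg) fc.
Qed.

(** The hypothesis is differentiability with zero differential; other functions are reduced to this
    case by subtracting a linear map. *)
Lemma littleo_differentiable (V : normedModType R) (f : V -> R) x :
  (forall e : R, 0 < e -> \forall y \near x, `|f y - f x| <= e * `|y - x|) ->
  differentiable f x.
Proof.
move=> fx; apply/diffP => /=.
have E : lim (nbhs x) = x by exact: lim_id.
apply: (@getPex _ (fun (df : {linear V -> R}) => continuous df /\
  forall y, f y = f (lim (nbhs x)) + df (y - lim (nbhs x))
                  +o_(y \near x) (y - lim (nbhs x)))).
exists (GRing.null_fun R : {linear V -> R}); split.
  by move=> y; exact: cst_continuous.
rewrite E; have H : f = cst (f x) +o_x (center x) by apply/eqaddoP.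
by apply: eqaddoEx => y; rewrite {1}H /= addr0.
Qed.

(** Both [y] and [z] vary, which is what a contraction estimate requires. The way from [y] to [z] is
    split into [n] steps along the axes; each is treated by the mean value theorem and the
    continuity of the partial derivatives at [x]. *)
Lemma C1_strict n (U : set 'rV[R]_n) f x : open U -> Ck 1 U f -> U x ->
  forall e : R, 0 < e -> exists2 d : R, 0 < d & forall y z : 'rV[R]_n,
    `|y - x| < d -> `|z - x| < d ->
    `|f z - f y - \sum_i (z - y) 0 i * 'D_(delta_mx 0 i) f x| <= e * `|z - y|.
Proof.
move=> oU [_ f1] Ux e e0.
(* With [n.+1] instead of [n], [e'] is positive even for [n = 0]. *)
pose e' : R := e / n.+1%:R.
have e'0 : 0 < e' by rewrite divr_gt0 // ltr0n.
have [d1 d10 dP1] := open_ball oU Ux.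
have [|d2 d20 dP2] := @exists_min R 'I_n (fun i d => forall w : 'rV[R]_n, `|w - x| < d ->
    `|'D_(delta_mx 0 i) f w - 'D_(delta_mx 0 i) f x| < e').
  move=> i; have [_ [/(_ x Ux) /continuous_ball/(_ _ e'0) [d d0 H] _]] := f1 (delta_mx 0 i).
  by exists d => // d' d'd w wx; apply: H; exact: lt_le_trans d'd.
pose d : R := Num.min d1 d2.
have d0 : 0 < d by rewrite lt_min d10.
have dP (w : 'rV[R]_n) : `|w - x| < d -> U w /\ forall i : 'I_n,
    `|'D_(delta_mx 0 i) f w - 'D_(delta_mx 0 i) f x| < e'.
  by rewrite lt_min => /andP[w1 w2]; split=> [|i]; [exact: dP1|exact: dP2].
exists d => // y z yd zd.
(* [p j] takes its first [j] coordinates from [z] and the others from [y], so that consecutive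
   points differ in one coordinate. *)
pose p (j : nat) : 'rV[R]_n := \row_i (if (i < j)%N then z 0 i else y 0 i).
have pS (j : 'I_n) : p j.+1 = p j + (z - y) 0 j *: delta_mx 0 j.
  apply/rowP => i; rewrite !mxE eqxx /= ltnS leq_eqVlt.
  case: (eqVneq i j) => [->|ij]; rewrite ?eqxx ?ltnn /=; first by ring.
  by rewrite -val_eqE /= in ij; rewrite (negbTE ij) /= mulr0 addr0.
have p0 : p 0 = y by apply/rowP => i; rewrite !mxE.
have pn : p n = z by apply/rowP => i; rewrite !mxE ltn_ord.
have pd (j : 'I_n) (t : R) : 0 <= t <= 1 -> `|p j + t *: ((z - y) 0 j *: delta_mx 0 j) - x| < d.
  move=> /andP[t0 t1]; apply: rV_norm_lt => // i.
  have yi : `|y 0 i - x 0 i| < d.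
    by apply: le_lt_trans yd; have := rV_coord_le (y - x) i; rewrite !mxE.
  have zi : `|z 0 i - x 0 i| < d.
    by apply: le_lt_trans zd; have := rV_coord_le (z - x) i; rewrite !mxE.
  rewrite !mxE eqxx /=; case: (eqVneq i j) => [<-|ij]; last first.
    by rewrite !mulr0 addr0; case: ifP.
  rewrite ltnn /= mulr1.
  (* The moving coordinate is a convex combination of those of [y] and [z], so the segment stays in
     the ball of the sup norm. *)
  have -> : y 0 i + t * (z 0 i - y 0 i) - x 0 i =
     (1 - t) * (y 0 i - x 0 i) + t * (z 0 i - x 0 i) by ring.
  have t1' : 0 <= 1 - t by rewrite subr_ge0.
  apply: le_lt_trans (ler_normD _ _) _; rewrite !normrM (ger0_norm t0) (ger0_norm t1').
  have [->|tn0] := eqVneq t 0; first by rewrite subr0 mul1r mul0r addr0.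
  have tp : 0 < t by rewrite lt_neqAle eq_sym tn0.
  have : (1 - t) * `|y 0 i - x 0 i| <= (1 - t) * d by rewrite ler_wpM2l // ltW.
  have : t * `|z 0 i - x 0 i| < t * d by rewrite ltr_pM2l.
  lra.
have -> : f z - f y = \sum_(j < n) (f (p j.+1) - f (p j)).
  by rewrite -p0 -pn -(telescope_sumr (f \o p) (leq0n n)) big_mkord.
rewrite -sumrB.
apply: le_trans (ler_norm_sum _ _ _) _.
have -> : e * `|z - y| = e' * `|z - y| * n%:R + e' * `|z - y|.
  by rewrite /e' -natr1; field; rewrite natr1 pnatr_eq0.
apply: (@le_trans _ _ (\sum_(j < n) e' * `|z - y|)); last first.
  have N0 : 0 <= e' * `|z - y| by rewrite mulr_ge0 // ltW.
  by rewrite sumr_const card_ord -mulr_natr; lra.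
apply: ler_sum => j _; rewrite pS.
have dU (t : R) : 0 <= t <= 1 -> U (p j + t *: ((z - y) 0 j *: delta_mx 0 j)) /\
   `|'D_(delta_mx 0 j) f x - 'D_(delta_mx 0 j) f (p j + t *: ((z - y) 0 j *: delta_mx 0 j))| < e'.
  move=> t01; have [? ?] := dP _ (pd j t t01).
  by split=> //; rewrite distrC.
have [t /dU[+ _]|c c01 ->] := @MVT_dir _ _ f (p j) ((z - y) 0 j *: delta_mx 0 j).
  by move=> Ut; apply: derivableZdir; have [/(_ _ Ut)] := f1 (delta_mx 0 j).
have [Uc Dc] := dU _ c01.
rewrite deriveZdir; last by have [/(_ _ Uc)] := f1 (delta_mx 0 j).
rewrite -mulrBr normrM mulrC ler_pM // ?normr_ge0 //; last exact: rV_coord_le.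
by rewrite distrC ltW.
Qed.

(** [L] is the candidate differential; strict differentiability with one point fixed at [x] shows
    that [f - L] has zero differential. *)
Lemma C1_differentiable n (U : set 'rV[R]_n) f x : open U -> Ck 1 U f -> U x ->
  differentiable f x.
Proof.
move=> oU f1 Ux.
pose L := \sum_(i < n) ('D_(delta_mx 0 i) f x *: (fun y : 'rV[R]_n => y 0 i)).
have dL : differentiable L x.
  by apply: differentiable_sum => i; apply: differentiableZ; exact: differentiable_coord.
rewrite -(subrK L f); apply: differentiableD => //.
apply: littleo_differentiable => e e0.
have [d d0 H] := C1_strict oU f1 Ux e0.
apply/nbhs_normP; exists d => //= y; rewrite /= distrC => yd.
have := H x y; rewrite subrr normr0 => /(_ d0 yd).
suff -> : \sum_i (y - x) 0 i * 'D_(delta_mx 0 i) f x = L y - L x.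
  by rewrite -![(f - L) _]/(f _ - L _) (_ : _ - _ - (_ - _) = f y - L y - (f x - L x)) //; ring.
rewrite /L !fct_sumE -sumrB; apply: eq_bigr => i _.
by rewrite !mxE /= -![(_ *: (fun _ => _)) _]/(_ *: _) -scalerBr mulrC.
Qed.

Lemma C1_deriveE n (U : set 'rV[R]_n) f x v : open U -> Ck 1 U f -> U x ->
  'D_v f x = \sum_i v 0 i * 'D_(delta_mx 0 i) f x.
Proof.
move=> oU f1 Ux; have df := C1_differentiable oU f1 Ux.
rewrite deriveE // {1}(row_sum_delta v) linear_sum /=.
by apply: eq_bigr => i _; rewrite linearZ /= deriveE.
Qed.

Lemma dist2_lt (a b c e : R) :
  `|a - b| < e / 2 -> `|a - c| < e / 2 -> `|b - c| <= e.
Proof.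
rewrite !ltr_norml ler_norml => /andP[? ?] /andP[? ?].
by apply/andP; split; lra.
Qed.

Lemma subrACA (a b c d : R) : a - b - (c - d) = a - c - (b - d).
Proof. by ring. Qed.

Lemma C2_schwarz n (U : set 'rV[R]_n) f x u v : open U -> Ck 2 U f -> U x ->
  'D_u (fun y => 'D_v f y) x = 'D_v (fun y => 'D_u f y) x.
Proof.
move=> oU [_ f2] Ux.
apply/eqP; rewrite -subr_eq0 -normr_eq0; apply/eqP/le_anti/andP; split=> //.
apply/ler_addgt0Pl => e e0; rewrite addr0.
have e20 : 0 < e / 2 by rewrite divr_gt0.
have [d1 d10 dP1] := open_ball oU Ux.
have [_ [_ /(_ u) [_ [/(_ x Ux)/continuous_ball/(_ _ e20) [d2 d20 dP2] _]]]] := f2 v.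
have [_ [_ /(_ v) [_ [/(_ x Ux)/continuous_ball/(_ _ e20) [d3 d30 dP3] _]]]] := f2 u.
pose d : R := Num.min d1 (Num.min d2 d3).
have d0 : 0 < d by rewrite !lt_min d10 d20.
have dP (w : 'rV[R]_n) : `|w - x| < d -> [/\ U w,
   `|'D_u (fun y => 'D_v f y) w - 'D_u (fun y => 'D_v f y) x| < e / 2 &
   `|'D_v (fun y => 'D_u f y) w - 'D_v (fun y => 'D_u f y) x| < e / 2].
  have [dd1 dd2 dd3] : [/\ d <= d1, d <= d2 & d <= d3].
    by rewrite /d !ge_min !lexx !orbT.
  move=> wd; split; first exact: dP1 (lt_le_trans wd dd1).
    exact: dP2 (lt_le_trans wd dd2).
  exact: dP3 (lt_le_trans wd dd3).
(* This scale keeps the parallelogram spanned by [s *: u] and [s *: v] inside the ball of radius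
   [d]; the summand 1 covers [u = v = 0]. *)
pose s : R := d / (`|u| + `|v| + 1).
have S0 : 0 < `|u| + `|v| + 1 by rewrite ltr_wpDl // addr_ge0.
have s0 : 0 < s by rewrite divr_gt0.
have in_ball (a b : R) : 0 <= a <= 1 -> 0 <= b <= 1 ->
    `|x + a *: (s *: u) + b *: (s *: v) - x| < d.
  move=> /andP[a0 a1] /andP[b0 b1]; rewrite -(addrA x) (addrC x) addrK.
  apply: le_lt_trans (ler_normD _ _) _; rewrite !normrZ !ger0_norm //; [|exact: ltW..].
  apply: (@le_lt_trans _ _ (s * (`|u| + `|v|))).
    rewrite mulrDr lerD // ler_piMl // mulr_ge0 //; exact: ltW.
  by rewrite /s mulrAC -mulrA gtr_pMr // ltr_pdivrMr // mul1r ltrDl.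
(* the double difference of f along s u and s v, computed in both orders *)
have mixed (w1 w2 : 'rV[R]_n) :
    (forall a b : R, 0 <= a <= 1 -> 0 <= b <= 1 ->
       U (x + a *: (s *: w1) + b *: (s *: w2))) ->
    exists a b : R, [/\ 0 <= a <= 1, 0 <= b <= 1 &
     f (x + s *: w1 + s *: w2) - f (x + s *: w1) - (f (x + s *: w2) - f x) =
     s * (s * 'D_w2 (fun y => 'D_w1 f y) (x + a *: (s *: w1) + b *: (s *: w2)))].
  move=> Uab.
  have df1 (a b : R) : 0 <= a <= 1 -> 0 <= b <= 1 ->
      derivable f (x + a *: (s *: w1) + b *: (s *: w2)) w1.
    by move=> a01 b01; have [/(_ _ (Uab a b a01 b01))] := f2 w1.
  have i0 : 0 <= (0 : R) <= 1 by rewrite lexx ler01.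
  have i1 : 0 <= (1 : R) <= 1 by rewrite lexx ler01.
  pose phi := (f \o shift (s *: w2)) - f.
  have dphi (a : R) : 0 <= a <= 1 -> derivable phi (x + a *: (s *: w1)) w1.
    move=> a01; apply: derivableB.
      by apply/derivable_shiftE; have := df1 a 1 a01 i1; rewrite scale1r.
    by have := df1 a 0 a01 i0; rewrite scale0r addr0.
  have [|a a01 E1] := @MVT_dir _ _ phi x (s *: w1).
    by move=> a a01; apply: derivableZdir; exact: dphi.
  have [|b b01 E2] := @MVT_dir _ _ (fun y => 'D_w1 f y) (x + a *: (s *: w1)) (s *: w2).
    move=> b b01; apply: derivableZdir.
    by have [_ [_ /(_ w2) [+ _]]] := f2 w1; apply; exact: Uab.
  exists a, b; split=> //.
  have -> : f (x + s *: w1 + s *: w2) - f (x + s *: w1) - (f (x + s *: w2) - f x) =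
     phi (x + s *: w1) - phi x by [].
  rewrite E1 deriveZdir; last exact: dphi.
  congr (_ * _); rewrite deriveB; last 2 first.
    by apply/derivable_shiftE; have := df1 a 1 a01 i1; rewrite scale1r.
    by have := df1 a 0 a01 i0; rewrite scale0r addr0.
  rewrite derive_shiftE E2 deriveZdir //.
  by have [_ [_ /(_ w2) [+ _]]] := f2 w1; apply; exact: Uab.
have [|a [b [a01 b01 E1]]] := mixed u v.
  by move=> a b a01 b01; have [] := dP _ (in_ball a b a01 b01).
have [|b' [a' [b'01 a'01 E2]]] := mixed v u.
  by move=> a' b' a'01 b'01; rewrite addrAC; have [] := dP _ (in_ball b' a' b'01 a'01).
have Euv : x + s *: v + s *: u = x + s *: u + s *: v by rewrite addrAC.
rewrite Euv in E2.
have : s * (s * 'D_v (fun y => 'D_u f y) (x + a *: (s *: u) + b *: (s *: v))) =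
   s * (s * 'D_u (fun y => 'D_v f y) (x + b' *: (s *: v) + a' *: (s *: u))).
  exact: etrans (esym E1) (etrans (subrACA _ _ _ _) E2).
move=> /(mulfI (lt0r_neq0 s0)) /(mulfI (lt0r_neq0 s0)).
have [_ _ H1] := dP _ (in_ball a b a01 b01).
have [_ H2 _] := dP _ (in_ball a' b' a'01 b'01).
rewrite [x + b' *: _ + _]addrAC => E; rewrite E in H1.
exact: dist2_lt H2 H1.
Qed.

Lemma Ck_subset n k (U W : set 'rV[R]_n) f : W `<=` U -> Ck k U f -> Ck k W f.
Proof.
move=> WU; elim: k f => [|k IH] f /= [cf df]; (split; first by move=> x /WU/cf) => // v.
by have [dv Dv] := df v; split=> [x /WU/dv//|]; exact: IH.
Qed.

(** On a singleton [Ck] is not vacuous: its limits and derivatives are taken in the whole space, not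
    within the set. Smoothness can thus be tested point by point. *)
Lemma Ck_pointwise n k (U : set 'rV[R]_n) f :
  (forall x, U x -> Ck k [set x] f) -> Ck k U f.
Proof.
elim: k f => [|k IH] f /= fU; (split; first by move=> x /fU[+ _]; exact) => // v.
split=> [x /fU[_ /(_ v)[+ _]]|]; first exact.
by apply: IH => x /fU[_ /(_ v)[_]].
Qed.

Lemma Ck_pred n k (U : set 'rV[R]_n) f : Ck k.+1 U f -> Ck k U f.
Proof.
elim: k f => [|k IH] f [cf df]; first by split.
by split=> // v; have [dv Dv] := df v; split=> //; exact: IH.
Qed.

Lemma Ck_eq n k (U : set 'rV[R]_n) f g : open U -> (forall x, U x -> f x = g x) ->
  Ck k U f -> Ck k U g.
Proof.
move=> oU; elim: k f g => [|k IH] f g fg [cf df].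
  split=> // x Ux; apply: near_eq_continuous (cf x Ux).
  by apply: filterS (open_nbhs_nbhs (conj oU Ux)).
have nfg x : U x -> {near x, f =1 g}.
  by move=> Ux; apply: filterS (open_nbhs_nbhs (conj oU Ux)).
split=> [x Ux|v]; first exact: near_eq_continuous (nfg x Ux) (cf x Ux).
have [dv Dv] := df v; split=> [x Ux|].
  exact: near_eq_derivable (nfg x Ux) (dv x Ux).
by apply: IH Dv => x Ux; exact: near_eq_derive (nfg x Ux).
Qed.

Lemma Ck_cst n k (U : set 'rV[R]_n) (a : R) : Ck k U (cst a).
Proof.
elim: k a => [|k IH] a; (split; first by move=> x _; exact: cst_continuous) => //.
move=> v; split=> [x _|]; first exact: derivable_cst.
have -> : (fun x : 'rV[R]_n => 'D_v (cst a) x) = cst 0; last exact: IH.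
by apply/funext => x; rewrite derive_cst.
Qed.

Lemma Ck_coord n k (U : set 'rV[R]_n) i : Ck k U (fun x => x 0 i).
Proof.
case: k => [|k]; (split; first by move=> x _; exact: coord_continuous) => //.
have dc v (x : 'rV[R]_n) : derivable (fun x : 'rV[R]_n => x 0 i : R) x v.
  by apply: diff_derivable; exact: differentiable_coord.
move=> v; split=> [x _|]; first exact: dc.
have -> : (fun x : 'rV[R]_n => 'D_v (fun x : 'rV[R]_n => x 0 i : R) x) = cst (v 0 i).
  apply/funext => x; have /derivable_mxP H := @derivable_id R 'rV[R]_n x v.
  have := @derive_mx R 'rV[R]_n 1 n id x v.
  rewrite derive_id => /(_ (@derivable_id _ _ _ _)) /matrixP/(_ 0 i).
  by rewrite mxE => ->.
exact: Ck_cst.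
Qed.

Lemma CkD n k (U : set 'rV[R]_n) f g : open U -> Ck k U f -> Ck k U g ->
  Ck k U (fun x => f x + g x).
Proof.
move=> oU; elim: k f g => [|k IH] f g [cf df] [cg dg].
  by split=> // x Ux; apply: continuousD; [exact: cf|exact: cg].
split=> [x Ux|v]; first by apply: continuousD; [exact: cf|exact: cg].
have [dfv Dfv] := df v; have [dgv Dgv] := dg v; split=> [x Ux|].
  by apply: derivableD; [exact: dfv|exact: dgv].
apply: Ck_eq (IH _ _ Dfv Dgv) => // x Ux.
by rewrite -deriveD //; [exact: dfv|exact: dgv].
Qed.

Lemma CkM n k (U : set 'rV[R]_n) f g : open U -> Ck k U f -> Ck k U g ->
  Ck k U (fun x => f x * g x).
Proof.
move=> oU; elim: k f g => [|k IH] f g.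
  by move=> [cf _] [cg _]; split=> // x Ux; apply: continuousM; [exact: cf|exact: cg].
move=> fk gk; have [[cf df] [cg dg]] := (fk, gk).
split=> [x Ux|v]; first by apply: continuousM; [exact: cf|exact: cg].
have [dfv Dfv] := df v; have [dgv Dgv] := dg v; split=> [x Ux|].
  by apply: derivableM; [exact: dfv|exact: dgv].
apply: Ck_eq (CkD oU (IH _ _ (Ck_pred fk) Dgv) (IH _ _ (Ck_pred gk) Dfv)) => // x Ux.
by rewrite -[RHS]/(derive (f * g) x v) deriveM //; [exact: dfv|exact: dgv].
Qed.

Lemma Ck_sum n k (U : set 'rV[R]_n) (I : Type) (r : seq I) (P : pred I) (f : I -> 'rV[R]_n -> R) :
  open U -> (forall i, Ck k U (f i)) -> Ck k U (fun x => \sum_(i <- r | P i) f i x).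
Proof.
move=> oU fk; elim: r => [|i r IH].
  by apply: Ck_eq (Ck_cst k U 0) => // x _; rewrite big_nil.
case Pi: (P i).
  by apply: Ck_eq (CkD oU (fk i) IH) => // x _; rewrite big_cons Pi.
by apply: Ck_eq IH => // x _; rewrite big_cons Pi.
Qed.

Lemma Ck_inv n k (U : set 'rV[R]_n) f : open U -> (forall x, U x -> f x != 0) ->
  Ck k U f -> Ck k U (fun x => (f x)^-1).
Proof.
move=> oU f0; elim: k => [|k IH].
  by move=> [cf _]; split=> // x Ux; apply: continuousV; [exact: f0|exact: cf].
move=> fk; have [cf df] := fk; have gk := IH (Ck_pred fk).
split=> [x Ux|v]; first by apply: continuousV; [exact: f0|exact: cf].
have [dfv Dfv] := df v; split=> [x Ux|].
  by apply: derivableV; [exact: f0|exact: dfv].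
apply: Ck_eq (CkM oU (CkM oU (Ck_cst k U (-1)) (CkM oU gk gk)) Dfv) => // x Ux.
rewrite deriveV //; [|exact: f0|exact: dfv].
by rewrite /cst mulN1r -invfM -expr2.
Qed.

(** [g] is only known to be derivable along [v], so it is first restricted to the line through [x],
    where derivability is differentiability; [f] is differentiable because it is C^1. *)
Lemma is_derive_comp_rV n l (O : set 'rV[R]_l) f (g : 'rV[R]_n -> 'rV[R]_l) x v :
  open O -> O (g x) -> Ck 1 O f -> (forall i, derivable (fun y => g y 0 i) x v) ->
  is_derive x v (f \o g)
    (\sum_i 'D_v (fun y => g y 0 i) x * 'D_(delta_mx 0 i) f (g x)).
Proof.
move=> oO Ogx f1 dgi.
have dg : derivable g x v by apply/derivable_mxP => i j; rewrite ord1.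
have := dg => /derivable1P /derivable1_diffP dg1.
have dfg : differentiable f (g x) by exact: C1_differentiable oO f1 Ogx.
have dfg0 : differentiable f ((fun h : R => g (h *: v + x)) 0) by rewrite scale0r add0r.
have dc := differentiable_comp dg1 dfg0.
split; first by apply/derivable1P/derivable1_diffP.
rewrite derive_line deriveE // (diff_comp dg1 dfg0) /=.
rewrite scale0r add0r -(deriveE _ dfg) -(deriveE _ dg1) (C1_deriveE _ oO f1 Ogx).
apply: eq_bigr => i _; congr (_ * _).
rewrite derive_mx; last exact/derivable1_diffP.
by rewrite mxE [RHS]derive_line.
Qed.

(** By the chain rule a derivative of the composite is a sum of products of derivatives of [g] with
    partial derivatives of [f] composed with [g], to which the induction hypothesis applies. *)
Lemma Ck_comp n l k (U : set 'rV[R]_n) (O : set 'rV[R]_l) f (g : 'rV[R]_n -> 'rV[R]_l) :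
  open U -> open O -> (forall x, U x -> O (g x)) ->
  (forall i, Ck k U (fun x => g x 0 i)) -> Ck k O f -> Ck k U (f \o g).
Proof.
move=> oU oO gUO; elim: k f => [|k IH] f gk fk.
  split=> // x Ux; apply: continuous_comp; last by have [+ _] := fk; apply; exact: gUO.
  by apply: continuous_rV => i; have [+ _] := gk i; exact.
have cg x : U x -> {for x, continuous g}.
  by move=> Ux; apply: continuous_rV => i; have [+ _] := gk i; exact.
have f1 : Ck 1 O f by move: fk; clear; elim: k => // k IH /Ck_pred.
have is_der x v : U x -> is_derive x v (f \o g)
    (\sum_i 'D_v (fun x => g x 0 i) x * 'D_(delta_mx 0 i) f (g x)).
  move=> Ux.
  apply: is_derive_comp_rV (gUO _ Ux) f1 _ => // i.
  by have [_ /(_ v)[+ _]] := gk i; exact.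
split=> [x Ux|v].
  by apply: continuous_comp; [exact: cg|have [+ _] := fk; apply; exact: gUO].
split=> [x Ux|]; first by have [] := is_der x v Ux.
apply: (@Ck_eq _ _ _ (fun x => \sum_i 'D_v (fun x => g x 0 i) x * 'D_(delta_mx 0 i) f (g x))) => //.
  by move=> x Ux; have [_ ->] := is_der x v Ux.
apply: Ck_sum => // i; apply: CkM => //; first by have [_ /(_ v)[_]] := gk i.
apply: (IH (fun y => 'D_(delta_mx 0 i) f y)) => [j|]; first exact: Ck_pred.
by have [_ /(_ (delta_mx 0 i))[_]] := fk.
Qed.

End StrictDifferentiability.

(** [banach_fixed_point] is stated for complete normed modules. *)
HB.instance Definition _ (R : realType) m n := Complete.on 'M[R]_(m, n).

(** * Vectors tangent to a level set *)

Section LevelSet.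
Context {R : realType}.

Lemma norm_mulmx_le m n (w : 'rV[R]_m) (K : 'M[R]_(m, n)) :
  `|w *m K| <= `|w| * (\sum_i \sum_j `|K i j|).
Proof.
apply: rV_norm_le => [|j].
  by rewrite mulr_ge0 // sumr_ge0 // => i _; rewrite sumr_ge0.
rewrite mxE mulr_sumr; apply: le_trans (ler_norm_sum _ _ _) _.
apply: ler_sum => i _; rewrite normrM ler_pM ?rV_coord_le //.
by rewrite (bigD1 j) //= lerDl sumr_ge0.
Qed.

Lemma C1_strict_rV k m (W : set 'rV[R]_k) (s : 'rV[R]_k -> 'rV[R]_m) x :
  open W -> W x -> (forall i, Ck 1 W (fun y => s y 0 i)) ->
  forall e : R, 0 < e -> exists2 d : R, 0 < d & forall y z : 'rV[R]_k,
    `|y - x| < d -> `|z - x| < d ->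
    `|s z - s y - (z - y) *m (\matrix_(j, i) 'D_(delta_mx 0 j) (fun y => s y 0 i) x)|
      <= e * `|z - y|.
Proof.
move=> oW Wx s1 e e0.
have [|d d0 H] := @exists_min R 'I_m (fun i d => forall y z : 'rV[R]_k,
    `|y - x| < d -> `|z - x| < d ->
    `|s z 0 i - s y 0 i - \sum_j (z - y) 0 j * 'D_(delta_mx 0 j) (fun y => s y 0 i) x|
      <= e * `|z - y|).
  move=> i; have [d d0 H] := C1_strict oW (s1 i) Wx e0.
  exists d => // d' d'd y z yd zd.
  by apply: H; [exact: lt_le_trans yd d'd|exact: lt_le_trans zd d'd].
exists d => // y z yd zd; apply: rV_norm_le => [|i].
  by rewrite mulr_ge0 // ltW.
rewrite !mxE; apply: le_trans (H i y z yd zd); rewrite le_eqVlt; apply/orP; left.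
by apply/eqP; congr (`|_ - _|); apply: eq_bigr => j _; rewrite !mxE.
Qed.

(* The level set of s through x contains points at distance o(t) of x + t a,
   found as fixed points of a contraction, although it is not parametrized. *)
Lemma derive_level_set k m (W : set 'rV[R]_k) (s : 'rV[R]_k -> 'rV[R]_m)
    (E : 'rV[R]_k -> R) x a :
  open W -> W x -> (forall i, Ck 1 W (fun y => s y 0 i)) -> Ck 1 W E ->
  (forall b : 'rV[R]_m, exists h, forall i, 'D_h (fun y => s y 0 i) x = b 0 i) ->
  (forall i, 'D_a (fun y => s y 0 i) x = 0) ->
  (forall y, W y -> s y = s x -> E y = E x) ->
  'D_a E x = 0.
Proof.
move=> oW Wx s1 E1 surj a0 level.
pose J : 'M[R]_(k, m) := \matrix_(j, i) 'D_(delta_mx 0 j) (fun y => s y 0 i) x.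
have JE (h : 'rV[R]_k) i : (h *m J) 0 i = 'D_h (fun y => s y 0 i) x.
  by rewrite (C1_deriveE _ oW (s1 i) Wx) mxE; apply: eq_bigr => j _; rewrite mxE.
(* Vectors are rows, so a right inverse of the differential of [s] is a matrix [K] with
   [w *m K *m J = w]; its rows are preimages of the basis vectors. *)
have [K KJ] : exists K : 'M[R]_(m, k), K *m J = 1%:M.
  have /choice [h hP] := fun l : 'I_m => surj (delta_mx 0 l).
  exists (\matrix_(l, j) h l 0 j); apply/matrixP => l i.
  have <- : (h l *m J) 0 i = (1%:M : 'M[R]_m) l i.
    by rewrite JE hP !mxE eqxx eq_sym.
  by rewrite !mxE; apply: eq_bigr => j _; rewrite !mxE.
have aJ : a *m J = 0 by apply/rowP => i; rewrite JE a0 mxE.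
pose C : R := (\sum_i \sum_j `|K i j|) + 1.
have C0 : 0 < C.
  by rewrite ltr_wpDl // sumr_ge0 // => i _; rewrite sumr_ge0.
have KC (w : 'rV[R]_m) : `|w *m K| <= C * `|w|.
  apply: le_trans (norm_mulmx_le _ _) _.
  by rewrite mulrC ler_wpM2r // lerDl.
pose A : R := `|a| + 1.
have A0 : 0 < A by rewrite ltr_wpDl.
pose L : R := (\sum_j `|'D_(delta_mx 0 j) E x|) + 1.
have L0 : 0 < L by rewrite ltr_wpDl // sumr_ge0.
(* [eta] is the precision of strict differentiability for [s] and [E]. The factor of [eta] on the
   right does not depend on it, so the conclusion follows when [eta] tends to 0. *)
have bound (eta : R) : 0 < eta -> eta * C <= 1 / 2 ->
    `|'D_a E x| <= eta * (2 * L * C * A + A).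
  move=> eta0 etaC.
  have [d1 d10 Hs] := C1_strict_rV oW Wx s1 eta0.
  have [d2 d20 HE] := C1_strict oW E1 Wx eta0.
  (* Precision 1 is enough here: it makes [E] Lipschitz near [x] with constant [L], whose summand 1
     comes from it. *)
  have [d3 d30 HL] := C1_strict oW E1 Wx ltr01.
  have [d4 d40 HW] := open_ball oW Wx.
  pose d : R := Num.min (Num.min d1 d2) (Num.min d3 d4).
  have d0 : 0 < d by rewrite !lt_min d10 d20 d30.
  have [dd1 dd2 dd3 dd4] : [/\ d <= d1, d <= d2, d <= d3 & d <= d4].
    by rewrite /d !ge_min !lexx !orbT.
  (* [y] lies within [t * A = d / 4] of [x], and the correction [w *m K] has norm at most
     [C * r <= d / 4] since [eta * C <= 1 / 2]; all points involved thus stay in the ball of radius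
     [d]. *)
  pose t : R := d / (4 * A).
  have t0 : 0 < t by rewrite divr_gt0 // mulr_gt0.
  have tA : t * A = d / 4 by rewrite /t invfM mulrA mulfVK // gt_eqF.
  pose y : 'rV[R]_k := x + t *: a.
  (* Twice the bound [eta * (t * A)] on the norm of [Phi 0]: with contraction factor 1/2, [Phi] then
     maps the ball of radius [r] to itself. *)
  pose r : R := 2 * eta * (t * A).
  have r0 : 0 <= r by rewrite /r tA; apply/ltW/mulr_gt0; [exact: mulr_gt0 |exact: divr_gt0].
  have yx : `|y - x| <= t * A.
    by rewrite /y addrC addKr normrZ gtr0_norm // ler_wpM2l ?lerDl // ltW.
  have zx (w : 'rV[R]_m) : `|w| <= r -> `|y + w *m K - x| < d.
    move=> wr; rewrite addrAC; apply: le_lt_trans (ler_normD _ _) _.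
    have : C * `|w| <= t * A.
      apply: (@le_trans _ _ (C * r)); first by rewrite ler_wpM2l // ltW.
      have -> : C * r = 2 * (eta * C) * (t * A) by rewrite /r; ring.
      by rewrite ler_piMl //; [rewrite tA divr_ge0 // ltW|lra].
    have := KC w; lra.
  (* Newton's iteration with the differential frozen at [x]: a fixed point [w] satisfies
     [s (y + w *m K) = s x]. *)
  pose Phi (w : 'rV[R]_m) := w - (s (y + w *m K) - s x).
  pose B : set 'rV[R]_m := closed_ball_ Num.norm 0 r.
  have BE w : B w = (`|w| <= r) by rewrite /B /closed_ball_ /= sub0r normrN.
  have Phi_lip (w w' : 'rV[R]_m) : `|w| <= r -> `|w'| <= r ->
      `|Phi w - Phi w'| <= 1 / 2 * `|w - w'|.
    move=> wr w'r.
    have := Hs _ _ (lt_le_trans (zx w' w'r) dd1) (lt_le_trans (zx w wr) dd1).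
    have dz : y + w *m K - (y + w' *m K) = (w - w') *m K.
      by rewrite opprD addrACA subrr add0r mulmxBl.
    rewrite dz -/J -mulmxA KJ mulmx1 => H.
    have -> : Phi w - Phi w' = - (s (y + w *m K) - s (y + w' *m K) - (w - w')).
      by apply/rowP => i; rewrite /Phi !mxE; ring.
    rewrite normrN; apply: le_trans H _.
    apply: (@le_trans _ _ (eta * (C * `|w - w'|))).
      by rewrite ler_wpM2l // ltW.
    by rewrite mulrA ler_wpM2r.
  have Phi0 : `|Phi 0| <= r / 2.
    have := Hs x y; rewrite subrr normr0 => /(_ d10).
    have -> : Phi 0 = - (s y - s x - (y - x) *m J).
      have -> : (y - x) *m J = 0 by rewrite /y addrC addKr -scalemxAl aJ scaler0.
      by rewrite /Phi mul0mx addr0 subr0 sub0r.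
    rewrite normrN => H; apply: le_trans (H _) _.
      by apply: le_lt_trans yx _; rewrite tA; lra.
    have -> : r / 2 = eta * (t * A) by rewrite /r; field.
    by rewrite ler_wpM2l // ltW.
  have PhiB : set_fun B B Phi.
    move=> w; rewrite !BE => wr.
    have := @Phi_lip w 0 wr; rewrite normr0 subr0 => /(_ r0) H.
    rewrite -(subrK (Phi 0) (Phi w)); apply: le_trans (ler_normD _ _) _.
    move: H Phi0 wr; lra.
  pose PhiF : {fun B >-> B} := HB.pack Phi (isFun.Build _ _ B B Phi PhiB).
  have ctr : is_contraction PhiF.
    exists (1 / 2)%:nng; split=> /=; first by lra.
    move=> [w w'] [/= Bw Bw']; apply: Phi_lip; by rewrite -BE.
  have [||w] := banach_fixed_point ctr.
  - exact: closed_closed_ball_.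
  - by exists 0; rewrite BE normr0.
  rewrite BE /= => wr /esym/eqP; rewrite /Phi -subr_eq0 addrAC subrr add0r oppr_eq0 subr_eq0.
  move=> /eqP sw; pose z := y + w *m K.
  have zd := zx w wr.
  have Ez : E z = E x by apply: level => //; apply: HW; exact: lt_le_trans zd dd4.
  have yd : `|y - x| < d by apply: le_lt_trans yx _; rewrite tA; lra.
  have H1 := HL _ _ (lt_le_trans yd dd3) (lt_le_trans zd dd3).
  have H2 := HE x y; rewrite subrr normr0 in H2.
  have {}H2 := H2 d20 (lt_le_trans yd dd2).
  have zy : `|z - y| <= C * r.
    by rewrite /z addrC addKr; apply: le_trans (KC w) _; rewrite ler_wpM2l // ltW.
  have H3 : `|\sum_j (z - y) 0 j * 'D_(delta_mx 0 j) E x| <= (L - 1) * `|z - y|.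
    rewrite /L addrK mulr_suml; apply: le_trans (ler_norm_sum _ _ _) _.
    by apply: ler_sum => j _; rewrite normrM mulrC ler_wpM2l // rV_coord_le.
  have H4 : \sum_j (y - x) 0 j * 'D_(delta_mx 0 j) E x = t * 'D_a E x.
    rewrite (C1_deriveE a oW E1 Wx) mulr_sumr; apply: eq_bigr => j _.
    by rewrite /y addrC addKr mxE mulrA.
  rewrite H4 in H2; rewrite Ez in H1.
  have {zy} H5 : `|E x - E y| <= L * (C * r).
    apply: (@le_trans _ _ (L * `|z - y|)); last by rewrite ler_wpM2l // ltW.
    rewrite -(subrK (\sum_j (z - y) 0 j * 'D_(delta_mx 0 j) E x) (E x - E y)).
    by apply: le_trans (ler_normD _ _) _; move: H1 H3; lra.
  have H6 : `|t * 'D_a E x| <= L * (C * r) + eta * (t * A).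
    have -> : t * 'D_a E x = - (E x - E y) - (E y - E x - t * 'D_a E x) by ring.
    apply: le_trans (ler_normB _ _) _; rewrite normrN lerD //.
    by apply: le_trans H2 _; rewrite ler_wpM2l // ltW.
  rewrite -(ler_pM2l t0) -[X in X * `|_|](gtr0_norm t0) -normrM.
  apply: le_trans H6 _; rewrite le_eqVlt; apply/orP; left; apply/eqP.
  by rewrite /r; ring.
apply/eqP; rewrite -normr_eq0; apply/eqP/le_anti/andP; split=> //.
pose B : R := 2 * L * C * A + A.
have B0 : 0 < B by rewrite addr_gt0 // !mulr_gt0.
apply/ler_addgt0Pl => e e0; rewrite addr0.
(* The first term makes the estimate at most [e], the second makes [Phi] a contraction. *)
pose eta : R := Num.min (e / B) (1 / 2 / C).
have eta0 : 0 < eta by rewrite lt_min !divr_gt0.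
apply: le_trans (bound eta eta0 _) _; rewrite -?ler_pdivlMr // ge_min lexx ?orbT //.
Qed.

End LevelSet.

(** * Germs of smooth functions *)

Section SmoothGerms.
Context {R : realType}.

Definition smooth_near n (x : 'rV[R]_n) (f : 'rV[R]_n -> R) : Prop :=
  exists U, [/\ open U, U x & smooth_in U f].

Lemma nbhs_openP (T : topologicalType) (x : T) (A : set T) :
  nbhs x A <-> exists U, [/\ open U, U x & U `<=` A].
Proof.
rewrite nbhsE; split=> [[U [oU Ux] UA]|[U [oU Ux UA]]]; first by exists U.
by exists U.
Qed.

Lemma smooth_nearP n (x : 'rV[R]_n) f :
  smooth_near x f <-> \forall y \near x, smooth_in [set y] f.
Proof.
split=> [[U [oU Ux Uf]]|/nbhs_openP[U [oU Ux Uf]]].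
  apply/nbhs_openP; exists U; split=> // y Uy k.
  by apply: Ck_subset (Uf k) => z ->.
by exists U; split=> // k; apply: Ck_pointwise => y /Uf.
Qed.

Lemma smooth_near_in n (x : 'rV[R]_n) (U : set 'rV[R]_n) f :
  nbhs x U -> smooth_in U f -> smooth_near x f.
Proof.
move=> /nbhs_openP[W [oW Wx WU]] Uf; exists W; split=> // k.
exact: Ck_subset (Uf k).
Qed.

Lemma smooth_near_at n (x : 'rV[R]_n) f : smooth_near x f -> smooth_in [set x] f.
Proof. by move=> [U [_ Ux Uf]] k; apply: Ck_subset (Uf k) => y ->. Qed.

Lemma smooth_near_near n (x : 'rV[R]_n) f :
  smooth_near x f -> \forall y \near x, smooth_near y f.
Proof.
by move=> [U [oU Ux Uf]]; apply/nbhs_openP; exists U; split=> // y Uy; exists U.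
Qed.

Lemma smooth_near_eq n (x : 'rV[R]_n) f g :
  {near x, f =1 g} -> smooth_near x f -> smooth_near x g.
Proof.
move=> /nbhs_openP[W [oW Wx fg]] [U [oU Ux Uf]].
exists (U `&` W); split=> //; first exact: openI.
move=> k; apply: (@Ck_eq _ _ _ _ f); first exact: openI.
  by move=> y [_ /fg].
exact: Ck_subset (Uf k).
Qed.

Lemma smooth_near_cst n (x : 'rV[R]_n) (a : R) : smooth_near x (cst a).
Proof. by exists setT; split=> [||k]; [exact: openT| |exact: Ck_cst]. Qed.

Lemma smooth_near_coord n (x : 'rV[R]_n) i : smooth_near x (fun y => y 0 i).
Proof. by exists setT; split=> [||k]; [exact: openT| |exact: Ck_coord]. Qed.

Lemma smooth_nearD n (x : 'rV[R]_n) f g :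
  smooth_near x f -> smooth_near x g -> smooth_near x (fun y => f y + g y).
Proof.
move=> [U [oU Ux Uf]] [W [oW Wx Wg]]; exists (U `&` W).
have oUW : open (U `&` W) by exact: openI.
by split=> // k; apply: CkD => //; [exact: Ck_subset (Uf k)|exact: Ck_subset (Wg k)].
Qed.

Lemma smooth_nearM n (x : 'rV[R]_n) f g :
  smooth_near x f -> smooth_near x g -> smooth_near x (fun y => f y * g y).
Proof.
move=> [U [oU Ux Uf]] [W [oW Wx Wg]]; exists (U `&` W).
have oUW : open (U `&` W) by exact: openI.
by split=> // k; apply: CkM => //; [exact: Ck_subset (Uf k)|exact: Ck_subset (Wg k)].
Qed.

Lemma smooth_near_continuous n (x : 'rV[R]_n) f :
  smooth_near x f -> {for x, continuous f}.
Proof. by move=> [U [_ Ux Uf]]; have [+ _] := Uf 0%N; exact. Qed.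

Lemma smooth_near_inv n (x : 'rV[R]_n) f :
  f x != 0 -> smooth_near x f -> smooth_near x (fun y => (f y)^-1).
Proof.
move=> fx0 sf; have := smooth_near_continuous sf.
have [U [oU Ux Uf]] := sf.
have o0 : open [set z : R | z != 0] by exact: open_neq.
move=> /(_ _ (open_nbhs_nbhs (conj o0 fx0))) /nbhs_openP[W [oW Wx Wf]].
exists (U `&` W); split=> //; first exact: openI.
move=> k; apply: Ck_inv; [exact: openI|by move=> y [_ /Wf]|].
exact: Ck_subset (Uf k).
Qed.

Lemma smooth_near_derive n (x : 'rV[R]_n) f v :
  smooth_near x f -> smooth_near x (fun y => 'D_v f y).
Proof.
move=> [U [oU Ux Uf]]; exists U; split=> // k.
by have [_ /(_ v)[_]] := Uf k.+1.
Qed.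

Lemma smooth_near_derivable n (x : 'rV[R]_n) f v : smooth_near x f -> derivable f x v.
Proof. by move=> [U [_ Ux Uf]]; have [_ /(_ v)[+ _]] := Uf 1%N; exact. Qed.

Lemma smooth_near_deriveE n (x : 'rV[R]_n) f v : smooth_near x f ->
  'D_v f x = \sum_i v 0 i * 'D_(delta_mx 0 i) f x.
Proof. by move=> [U [oU Ux Uf]]; exact: C1_deriveE oU (Uf 1%N) Ux. Qed.

Lemma smooth_near_schwarz n (x : 'rV[R]_n) f u v : smooth_near x f ->
  'D_u (fun y => 'D_v f y) x = 'D_v (fun y => 'D_u f y) x.
Proof. by move=> [U [oU Ux Uf]]; exact: C2_schwarz oU (Uf 2%N) Ux. Qed.

Lemma smooth_near_comp n l (x : 'rV[R]_n) f (g : 'rV[R]_n -> 'rV[R]_l) :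
  smooth_near (g x) f -> (forall i, smooth_near x (fun y => g y 0 i)) ->
  smooth_near x (f \o g).
Proof.
move=> [W [oW Wgx Wf]] sg.
have cg : {for x, continuous g}.
  by apply: continuous_rV => i; exact: smooth_near_continuous.
have : \forall y \near x, W (g y) /\ forall i, smooth_in [set y] (fun y => g y 0 i).
  apply: filterI; first exact: cg (open_nbhs_nbhs (conj oW Wgx)).
  apply: (@filter_forall _ _ (fun i (y : 'rV[R]_n) => smooth_in [set y] (fun y => g y 0 i)) (nbhs x)) => i.
  by apply/smooth_nearP.
move=> /nbhs_openP[U [oU Ux UW]]; exists U; split=> // k.
apply: Ck_comp (Wf k) => // [y /UW[]//|i].
by apply: Ck_pointwise => y /UW[_ /(_ i)].
Qed.

Lemma smooth_near_derive_comp n l (x : 'rV[R]_n) f (g : 'rV[R]_n -> 'rV[R]_l) v :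
  smooth_near (g x) f -> (forall i, smooth_near x (fun y => g y 0 i)) ->
  'D_v (f \o g) x = \sum_i 'D_v (fun y => g y 0 i) x * 'D_(delta_mx 0 i) f (g x).
Proof.
move=> [W [oW Wgx Wf]] sg.
have [|_ ->//] := @is_derive_comp_rV _ _ _ _ _ _ x v oW Wgx (Wf 1%N).
by move=> i; exact: smooth_near_derivable.
Qed.

End SmoothGerms.

(** * Smoothness on a manifold, read in one chart *)

Section Charts.
Context {R : realType} {m : nat} {M : manifold R m}.
Implicit Types (c d : chart R M m) (p q : M) (f g : M -> R).

Lemma cdom_nbhs c p : cdom c p -> nbhs p (cdom c).
Proof. by move=> cp; apply: open_nbhs_nbhs; split=> //; exact: cdom_open. Qed.

Lemma cmapKp c p : cdom c p -> cinv c (cmap c p) = p.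
Proof. by move=> cp; apply: cmapK; rewrite inE. Qed.

Lemma near_cinv c p (P : set M) : cdom c p -> nbhs p P ->
  \forall y \near cmap c p, P (cinv c y).
Proof.
move=> cp nP; have cy : (cmap c @` cdom c) (cmap c p) by exists p.
by have := cinv_continuous cy; rewrite /prop_for /continuous_at cmapKp //; exact.
Qed.

Lemma near_cmap c p (Q : set 'rV[R]_m) : cdom c p -> nbhs (cmap c p) Q ->
  \forall q \near p, Q (cmap c q).
Proof. by move=> cp nQ; exact: (cmap_continuous cp nQ). Qed.

Lemma near_cinvK c p : cdom c p ->
  \forall y \near cmap c p, cdom c (cinv c y) /\ cmap c (cinv c y) = y.
Proof.
move=> cp; have : nbhs (cmap c p) (cmap c @` cdom c).
  by apply: open_nbhs_nbhs; split; [exact: ccod_open|exists p].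
by apply: filterS => _ [q cq <-]; rewrite cmapKp.
Qed.

Lemma chart_image_nbhs c p (V : set M) : cdom c p -> nbhs p V ->
  nbhs (cmap c p) (cmap c @` (cdom c `&` V)).
Proof.
move=> cp nV; have := near_cinvK cp; apply: filterS2 (near_cinv cp nV) => y Vy [cy yK].
by exists (cinv c y).
Qed.

Lemma smooth_near_transition c d p i : atlas c -> atlas d -> cdom c p -> cdom d p ->
  smooth_near (cmap c p) (fun y => cmap d (cinv c y) 0 i).
Proof.
move=> ac ad cp dp; apply: smooth_near_in (atlas_compatible ac ad i).
by apply: chart_image_nbhs => //; exact: cdom_nbhs.
Qed.

Lemma smooth_near_chart c d p f : atlas c -> atlas d -> cdom c p -> cdom d p ->
  smooth_near (cmap c p) (f \o cinv c) -> smooth_near (cmap d p) (f \o cinv d).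
Proof.
move=> ac ad cp dp sf.
apply: (@smooth_near_eq _ _ _ ((f \o cinv c) \o (cmap c \o cinv d))).
  by apply: filterS (near_cinv dp (cdom_nbhs cp)) => y cy /=; rewrite cmapKp.
apply: smooth_near_comp => [|i] /=; first by rewrite cmapKp.
exact: smooth_near_transition.
Qed.

(** One chart decides because transition maps are smooth. For the converse, the open set is taken
    among the points of the chart domain that [cmap c] sends into [W], and smoothness is carried
    from [c] to the other charts at each of them. *)
Lemma smooth_atP c p f : atlas c -> cdom c p ->
  smooth_at p f <-> smooth_near (cmap c p) (f \o cinv c).
Proof.
move=> ac cp; split=> [[V [oV Vp /(_ c ac) Vf]]|[W [oW Wx Wf]]].
  apply: smooth_near_in Vf; apply: chart_image_nbhs => //.
  exact: open_nbhs_nbhs.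
have /nbhs_openP[V [oV Vp VW]] : \forall q \near p, cdom c q /\ W (cmap c q).
  apply: filterI; first exact: cdom_nbhs.
  by apply: near_cmap => //; exact: open_nbhs_nbhs.
exists V; split=> // d ad k; apply: Ck_pointwise => _ [q [dq /VW[cq Wq]] <-].
apply: smooth_near_at; apply: (smooth_near_chart ac ad cq dq).
by exists W.
Qed.

Lemma smooth_onP (V : set M) f : (forall p, V p -> smooth_at p f) -> smooth_on V f.
Proof.
move=> Vf c ac k; apply: Ck_pointwise => _ [q [cq /Vf sq] <-].
exact: smooth_near_at ((smooth_atP f ac cq).1 sq) k.
Qed.

Lemma smooth_at_near p f : smooth_at p f -> \forall q \near p, smooth_at q f.
Proof. by move=> [V [oV Vp Vf]]; apply/nbhs_openP; exists V; split=> // q Vq; exists V. Qed.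

Lemma smooth_at_eq p f g : {near p, f =1 g} -> smooth_at p f -> smooth_at p g.
Proof.
move=> fg; have [c ac cp] := atlas_cover p.
rewrite !(smooth_atP _ ac cp); apply: smooth_near_eq.
exact: near_cinv cp fg.
Qed.

Lemma smooth_at_cst p (a : R) : smooth_at p (cst a).
Proof.
have [c ac cp] := atlas_cover p; apply/(smooth_atP _ ac cp).
exact: (smooth_near_cst (cmap c p) a).
Qed.

Lemma smooth_atD p f g :
  smooth_at p f -> smooth_at p g -> smooth_at p (fun q => f q + g q).
Proof.
have [c ac cp] := atlas_cover p; rewrite !(smooth_atP _ ac cp); exact: smooth_nearD.
Qed.

Lemma smooth_atM p f g :
  smooth_at p f -> smooth_at p g -> smooth_at p (fun q => f q * g q).
Proof.
have [c ac cp] := atlas_cover p; rewrite !(smooth_atP _ ac cp); exact: smooth_nearM.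
Qed.

Lemma smooth_atB p f g :
  smooth_at p f -> smooth_at p g -> smooth_at p (fun q => f q - g q).
Proof.
move=> sf sg; apply: (@smooth_at_eq _ (fun q => f q + cst (-1) q * g q)).
  by apply: nearW => q; rewrite mulN1r.
by apply: smooth_atD => //; apply: smooth_atM => //; exact: smooth_at_cst.
Qed.

Lemma smooth_at_inv p f : f p != 0 -> smooth_at p f -> smooth_at p (fun q => (f q)^-1).
Proof.
have [c ac cp] := atlas_cover p; rewrite !(smooth_atP _ ac cp) => fp.
by apply: smooth_near_inv; rewrite /= cmapKp.
Qed.

Lemma smooth_at_sum p (I : Type) (r : seq I) (P : pred I) (f : I -> M -> R) :
  (forall i, smooth_at p (f i)) -> smooth_at p (fun q => \sum_(i <- r | P i) f i q).
Proof.
move=> sf; elim: r => [|i r IH].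
  by apply: smooth_at_eq (smooth_at_cst p 0); apply: nearW => q; rewrite big_nil.
case Pi: (P i).
  by apply: smooth_at_eq (smooth_atD (sf i) IH); apply: nearW => q; rewrite big_cons Pi.
by apply: smooth_at_eq IH; apply: nearW => q; rewrite big_cons Pi.
Qed.

Lemma smooth_at_prod p (I : Type) (r : seq I) (P : pred I) (f : I -> M -> R) :
  (forall i, smooth_at p (f i)) -> smooth_at p (fun q => \prod_(i <- r | P i) f i q).
Proof.
move=> sf; elim: r => [|i r IH].
  by apply: smooth_at_eq (smooth_at_cst p 1); apply: nearW => q; rewrite big_nil.
case Pi: (P i).
  by apply: smooth_at_eq (smooth_atM (sf i) IH); apply: nearW => q; rewrite big_cons Pi.
by apply: smooth_at_eq IH; apply: nearW => q; rewrite big_cons Pi.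
Qed.

Lemma smooth_at_comp n p (f : 'rV[R]_n -> R) (u : M -> 'rV[R]_n) :
  smooth_near (u p) f -> (forall i, smooth_at p (fun q => u q 0 i)) ->
  smooth_at p (f \o u).
Proof.
have [c ac cp] := atlas_cover p => sf su; apply/(smooth_atP _ ac cp).
apply: (@smooth_near_comp _ _ _ _ f (u \o cinv c)); first by rewrite /= cmapKp.
by move=> i; apply/(smooth_atP (fun q => u q 0 i) ac cp).
Qed.

Lemma smooth_at_continuous p f : smooth_at p f -> {for p, continuous f}.
Proof.
have [c ac cp] := atlas_cover p => /(smooth_atP _ ac cp)/smooth_near_continuous cf.
have : {for p, continuous ((f \o cinv c) \o cmap c)}.
  by apply: continuous_comp cf; exact: cmap_continuous.
apply: near_eq_continuous.
by apply: filterS (cdom_nbhs cp) => q cq /=; rewrite cmapKp.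
Qed.

Lemma continuous_smooth_at n p (u : M -> 'rV[R]_n) :
  (forall i, smooth_at p (fun q => u q 0 i)) -> {for p, continuous u}.
Proof. by move=> su; apply: continuous_rV => i; exact: smooth_at_continuous. Qed.

Lemma smooth_at_cmap c p i : atlas c -> cdom c p -> smooth_at p (fun q => cmap c q 0 i).
Proof.
move=> ac cp; apply/(smooth_atP _ ac cp).
apply: smooth_near_eq (smooth_near_coord _ i).
by apply: filterS (near_cinvK cp) => y [_ /= ->].
Qed.

End Charts.

(** * Tangent vectors and vector fields *)

Section TangentVectors.
Context {R : realType} {m : nat} {M : manifold R m}.
Implicit Types (c d : chart R M m) (p q : M) (f g : M -> R) (v w : functional R M).

Definition coord c i : M -> R := fun q => cmap c q 0 i.

Definition dcoord c i : M -> functional R M :=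
  fun q => chart_derivation c q (delta_mx 0 i).

Lemma chart_derivationE c p a f : smooth_at p f ->
  chart_derivation c p a f = 'D_a (f \o cinv c) (cmap c p).
Proof. by move=> sf; rewrite /chart_derivation asboolT. Qed.

Lemma tangent_junk p v f : tangent p v -> ~ smooth_at p f -> v f = 0.
Proof. by move=> [c [a [_ _ ->]]] nsf; rewrite /chart_derivation asboolF. Qed.

(** Smoothness at [p] is itself local, and both sides are 0 on functions that are not smooth at [p];
    so locality holds for arbitrary functions. *)
Lemma tangent_eq p v f g : tangent p v -> {near p, f =1 g} -> v f = v g.
Proof.
move=> tv fg; have [sf|nsf] := pselect (smooth_at p f); last first.
  rewrite !(tangent_junk tv) // => sg; apply: nsf; apply: smooth_at_eq sg.
  by apply: filterS fg => q ->.
have sg := smooth_at_eq fg sf.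
case: tv => c [a [ac cp ->]]; rewrite !chart_derivationE //.
by apply: near_eq_derive; exact: near_cinv cp fg.
Qed.

Lemma tangentD p v f g : tangent p v -> smooth_at p f -> smooth_at p g ->
  v (fun q => f q + g q) = v f + v g.
Proof.
move=> [c [a [ac cp ->]]] sf sg.
rewrite !chart_derivationE //; last exact: smooth_atD.
rewrite -deriveD //; apply: smooth_near_derivable; exact/smooth_atP.
Qed.

Lemma tangentM p v f g : tangent p v -> smooth_at p f -> smooth_at p g ->
  v (fun q => f q * g q) = f p * v g + g p * v f.
Proof.
move=> [c [a [ac cp ->]]] sf sg.
rewrite !chart_derivationE //; last exact: smooth_atM.
have := @deriveM _ _ (f \o cinv c) (g \o cinv c) (cmap c p) a.
rewrite /= cmapKp // => <- //; apply: smooth_near_derivable; exact/smooth_atP.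
Qed.

Lemma tangent_cst p v (a : R) : tangent p v -> v (cst a) = 0.
Proof.
move=> [c [b [ac cp ->]]]; rewrite chart_derivationE; last exact: smooth_at_cst.
exact: derive_cst.
Qed.

Lemma tangentB p v f g : tangent p v -> smooth_at p f -> smooth_at p g ->
  v (fun q => f q - g q) = v f - v g.
Proof.
move=> tv sf sg; apply: (canRL (addrK _)); rewrite -(tangentD tv) //; last exact: smooth_atB.
by apply: (tangent_eq tv); apply: nearW => q; rewrite subrK.
Qed.

Lemma tangent_sum p v (I : Type) (r : seq I) (f : I -> M -> R) : tangent p v ->
  (forall i, smooth_at p (f i)) ->
  v (fun q => \sum_(i <- r) f i q) = \sum_(i <- r) v (f i).
Proof.
move=> tv sf; elim: r => [|i r IH].
  rewrite big_nil; transitivity (v (cst 0)); last exact: tangent_cst tv.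
  by apply: (tangent_eq tv); apply: nearW => q; rewrite big_nil.
rewrite big_cons -IH -(tangentD tv) //; last exact: smooth_at_sum.
by apply: (tangent_eq tv); apply: nearW => q; rewrite big_cons.
Qed.

Lemma tangent_comp n p v (f : 'rV[R]_n -> R) (u : M -> 'rV[R]_n) :
  tangent p v -> smooth_near (u p) f -> (forall i, smooth_at p (fun q => u q 0 i)) ->
  v (f \o u) = \sum_i v (fun q => u q 0 i) * 'D_(delta_mx 0 i) f (u p).
Proof.
move=> [c [a [ac cp ->]]] sf su; rewrite chart_derivationE; last exact: smooth_at_comp.
have := @smooth_near_derive_comp _ _ _ (cmap c p) f (u \o cinv c) a.
rewrite /= cmapKp // => -> //; last by move=> i; exact/(smooth_atP (fun q => u q 0 i) ac cp).
by apply: eq_bigr => i _; rewrite chart_derivationE.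
Qed.

Lemma dcoordE c i p f : smooth_at p f ->
  dcoord c i p f = 'D_(delta_mx 0 i) (f \o cinv c) (cmap c p).
Proof. exact: chart_derivationE. Qed.

Lemma tangent_dcoord c i p : atlas c -> cdom c p -> tangent p (dcoord c i p).
Proof. by move=> ac cp; exists c, (delta_mx 0 i). Qed.

Lemma smooth_at_coord c p i : atlas c -> cdom c p -> smooth_at p (coord c i).
Proof. exact: smooth_at_cmap. Qed.

(** The vector may come from another chart: since [f] is [(f \o cinv c) \o cmap c] near [p], the
    chain rule rewrites it in [c]. *)
Lemma tangent_expand c p v f : atlas c -> cdom c p -> tangent p v -> smooth_at p f ->
  v f = \sum_i v (coord c i) * dcoord c i p f.
Proof.
move=> ac cp tv sf; rewrite (@tangent_eq _ _ _ ((f \o cinv c) \o cmap c) tv); last first.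
  by apply: filterS (cdom_nbhs cp) => q cq /=; rewrite cmapKp.
rewrite (tangent_comp tv); first by apply: eq_bigr => i _; rewrite dcoordE.
  exact/(smooth_atP _ ac cp).
by move=> i; exact: smooth_at_cmap.
Qed.

Lemma dcoord_coord c i j p : atlas c -> cdom c p ->
  dcoord c i p (coord c j) = (i == j)%:R.
Proof.
move=> ac cp; rewrite dcoordE; last exact: smooth_at_coord.
have -> : 'D_(delta_mx 0 i) (coord c j \o cinv c) (cmap c p) =
    'D_(delta_mx 0 i) (fun y : 'rV[R]_m => y 0 j : R) (cmap c p).
  apply: near_eq_derive; apply: filterS (near_cinvK cp) => y [_ yK].
  by rewrite /= /coord yK.
have := @derive_mx R 'rV[R]_m 1 m id (cmap c p) (delta_mx 0 i).
rewrite derive_id => /(_ (@derivable_id _ _ _ _)) /matrixP/(_ 0 j).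
by rewrite !mxE eqxx eq_sym => ->.
Qed.

Lemma chart_derivation_intro c p w (al : 'I_m -> R) : atlas c -> cdom c p ->
  (forall f, smooth_at p f -> w f = \sum_i al i * dcoord c i p f) ->
  (forall f, ~ smooth_at p f -> w f = 0) -> w = chart_derivation c p (\row_i al i).
Proof.
move=> ac cp wE w0; apply/funext => f.
have [sf|nsf] := pselect (smooth_at p f); last first.
  by rewrite w0 // /chart_derivation asboolF.
rewrite wE // chart_derivationE // (smooth_near_deriveE _ ((smooth_atP f ac cp).1 sf)).
by apply: eq_bigr => i _; rewrite mxE dcoordE.
Qed.

Lemma tangent_intro c p w (al : 'I_m -> R) : atlas c -> cdom c p ->
  (forall f, smooth_at p f -> w f = \sum_i al i * dcoord c i p f) ->
  (forall f, ~ smooth_at p f -> w f = 0) -> tangent p w.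
Proof.
move=> ac cp wE w0; exists c, (\row_i al i); split=> //.
exact: chart_derivation_intro.
Qed.

Lemma tangent_chart c p v : atlas c -> cdom c p -> tangent p v ->
  v = chart_derivation c p (\row_i v (coord c i)).
Proof.
move=> ac cp tv; apply: chart_derivation_intro => // f sf; first exact: tangent_expand.
exact: tangent_junk sf.
Qed.

Lemma tangent_chart_derivation c p a : atlas c -> cdom c p ->
  tangent p (chart_derivation c p a).
Proof. by exists c, a. Qed.

Lemma chart_derivation_coord c p a i : atlas c -> cdom c p ->
  chart_derivation c p a (coord c i) = a 0 i.
Proof.
move=> ac cp; have sc := smooth_at_coord i ac cp.
rewrite chart_derivationE // (smooth_near_deriveE _ ((smooth_atP _ ac cp).1 sc)).
rewrite (bigD1 i) //= big1 => [|j ji]; rewrite -dcoordE // dcoord_coord //.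
  by rewrite eqxx mulr1 addr0.
by rewrite (negbTE ji) mulr0.
Qed.

Lemma tangent_lin p (a : R) v w : tangent p v -> tangent p w -> tangent p (a *: v + w).
Proof.
move=> tv tw; have [c ac cp] := atlas_cover p.
(* The two vectors may come from different charts; both are expanded in [c]. *)
apply: (@tangent_intro c p _ (fun i => a * v (coord c i) + w (coord c i))) => // f sf.
  rewrite (_ : (a *: v + w) f = a * v f + w f) //.
  rewrite (tangent_expand ac cp tv) // (tangent_expand ac cp tw) // mulr_sumr -big_split /=.
  by apply: eq_bigr => i _; ring.
by rewrite (_ : (a *: v + w) f = a * v f + w f) // (tangent_junk tv) // (tangent_junk tw) // mulr0 addr0.
Qed.

Lemma tangent0 p : tangent p (0 : functional R M).
Proof.
have [c ac cp] := atlas_cover p.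
apply: (@tangent_intro c p _ (fun i => 0)) => // f sf.
by rewrite big1 // => i _; rewrite mul0r.
Qed.

Lemma tangentZ p (a : R) v : tangent p v -> tangent p (a *: v).
Proof. by move=> tv; rewrite -[a *: v]addr0; apply: tangent_lin => //; exact: tangent0. Qed.

Lemma tangent_add p v w : tangent p v -> tangent p w -> tangent p (v + w).
Proof. by move=> tv tw; rewrite -[v]scale1r; exact: tangent_lin. Qed.

Lemma tangent_opp p v : tangent p v -> tangent p (- v).
Proof. by move=> tv; rewrite -scaleN1r; exact: tangentZ. Qed.

Lemma tangent_ext p v w : tangent p v -> tangent p w ->
  (forall f, smooth_at p f -> v f = w f) -> v = w.
Proof.
move=> tv tw vw; apply/funext => f; have [/vw//|nsf] := pselect (smooth_at p f).
by rewrite (tangent_junk tv) // (tangent_junk tw).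
Qed.

Lemma tangent_dcoordE c p v : atlas c -> cdom c p -> tangent p v ->
  v = \sum_i v (coord c i) *: dcoord c i p.
Proof.
move=> ac cp tv; apply: (tangent_ext tv).
  elim/big_ind: _ => [|u w|i _]; [exact: tangent0|exact: tangent_add|].
  by apply: tangentZ; exact: tangent_dcoord.
by move=> f sf; rewrite (tangent_expand ac cp tv sf) fct_sumE.
Qed.

Lemma dcoord_schwarz c i j p f : atlas c -> cdom c p -> smooth_at p f ->
  dcoord c i p (fun q => dcoord c j q f) = dcoord c j p (fun q => dcoord c i q f).
Proof.
move=> ac cp sf; have snf := (smooth_atP f ac cp).1 sf.
have E l : \forall y \near cmap c p,
    dcoord c l (cinv c y) f = 'D_(delta_mx 0 l) (f \o cinv c) y.
  apply: filterS2 (near_cinvK cp) (near_cinv cp (smooth_at_near sf)) => y [cy yK] sy.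
  by rewrite dcoordE // yK.
have S l : smooth_at p (fun q => dcoord c l q f).
  apply/(smooth_atP _ ac cp).
  apply: (@smooth_near_eq _ _ _ (fun y => 'D_(delta_mx 0 l) (f \o cinv c) y)).
    by apply: filterS (E l) => y /= ->.
  exact: smooth_near_derive.
rewrite dcoordE; last exact: S; rewrite dcoordE; last exact: S.
apply: etrans (near_eq_derive _ (E j)) _.
apply: etrans (smooth_near_schwarz _ _ snf) _.
by apply/esym/near_eq_derive; exact: E.
Qed.

Lemma smooth_at_chart_derivation c a p f : atlas c -> cdom c p -> smooth_at p f ->
  smooth_at p (fun q => chart_derivation c q a f).
Proof.
move=> ac cp sf; have snf := (smooth_atP f ac cp).1 sf.
apply/(smooth_atP _ ac cp).
apply: (@smooth_near_eq _ _ _ (fun y => 'D_a (f \o cinv c) y)).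
  apply: filterS2 (near_cinvK cp) (near_cinv cp (smooth_at_near sf)) => y [cy yK] sy.
  by rewrite /= chart_derivationE // yK.
exact: smooth_near_derive.
Qed.

End TangentVectors.

(** * Smooth maps and push-forward of tangent vectors *)

Section Maps.
Context {R : realType} {m n : nat} {M : manifold R m} {N : manifold R n}.

Lemma smooth_at_smooth_map (F : M -> N) p f :
  smooth_map F -> smooth_at (F p) f -> smooth_at p (f \o F).
Proof.
move=> [cF sF] sf; have [c ac cp] := atlas_cover p.
have [d ad dp] := atlas_cover (F p).
have nd : \forall q \near p, cdom d (F q) by exact: cF (cdom_nbhs dp).
apply: (@smooth_at_eq _ _ _ _ ((f \o cinv d) \o (cmap d \o F))).
  by apply: filterS nd => q dq /=; rewrite cmapKp.
apply: smooth_at_comp => [|i] /=; first exact/(smooth_atP _ ad dp).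
apply/(smooth_atP (fun q => cmap d (F q) 0 i) ac cp).
by apply: smooth_near_in (sF c d ac ad i); exact: chart_image_nbhs.
Qed.

(* Both dF and the differentials of right translations have the form of w. *)
Lemma tangent_push c (p : M) (q : N) v (u : M -> 'rV[R]_n) (w : functional R N) :
  atlas c -> cdom c q -> tangent p v -> u p = cmap c q ->
  (forall i, smooth_at p (fun x => u x 0 i)) ->
  (forall f, smooth_at q f -> w f = v ((f \o cinv c) \o u)) ->
  (forall f, ~ smooth_at q f -> w f = 0) -> tangent q w.
Proof.
move=> ac cq tv up su wE w0.
apply: (@tangent_intro _ _ _ c q w (fun i => v (fun x => u x 0 i))) => // f sf.
rewrite wE // (tangent_comp tv) //; last by rewrite up; exact/(smooth_atP _ ac cq).
by apply: eq_bigr => i _; rewrite dcoordE // up.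
Qed.

Lemma dmapE (F : M -> N) p v f : smooth_at (F p) f -> dmap F p v f = v (f \o F).
Proof. by move=> sf; rewrite /dmap asboolT. Qed.

Lemma dmap_tangent (F : M -> N) p v :
  smooth_map F -> tangent p v -> tangent (F p) (dmap F p v).
Proof.
move=> sF tv; have [d ad dp] := atlas_cover (F p).
apply: (@tangent_push d p (F p) v (cmap d \o F)) => // [i|f sf|f nsf].
- exact: (smooth_at_smooth_map sF (smooth_at_cmap i ad dp)).
- rewrite dmapE //; apply: (tangent_eq tv).
  have [cF _] := sF; have nd : \forall q \near p, cdom d (F q) by exact: cF (cdom_nbhs dp).
  by apply: filterS nd => q dq /=; rewrite cmapKp.
- by rewrite /dmap asboolF.
Qed.

Lemma dmap_lin (F : M -> N) p (a : R) v w : dmap F p (a *: v + w) = a *: dmap F p v + dmap F p w.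
Proof.
apply/funext => f; rewrite /dmap.
rewrite -[RHS]/(a * (if _ then _ else _) + (if _ then _ else _)).
by case: ifP => // _; rewrite mulr0 addr0.
Qed.

(** Functions smooth on an open set are traded for germs; openness of [V] and continuity of [u] keep
    the set on which smoothness is tested open. *)
Lemma smooth_alongP (u : M -> N) (V : set M) X : continuous u -> open V ->
  smooth_along u V X <-> forall p, V p -> tangent (u p) (X p) /\
    forall f, smooth_at (u p) f -> smooth_at p (fun x => X x f).
Proof.
move=> cu oV; split=> [[tX sX] p Vp|H].
  split=> [|f [W [oW Wp Wf]]]; first exact: tX.
  exists (V `&` u @^-1` W); split=> //; last exact: sX.
  by apply: openI => //; exact: open_comp (fun x _ => cu x) oW.
split=> [p /H[]//|W f oW Wf]; apply: smooth_onP => p [Vp Wp].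
by have [_] := H p Vp; apply; exists W.
Qed.

End Maps.

(** * Germs of vector fields and their Lie bracket *)

Section Fields.
Context {R : realType} {m : nat} {M : manifold R m}.
Implicit Types (c : chart R M m) (p q : M) (f g : M -> R) (X Y : M -> functional R M).

(** What a bracket at [p] requires of a field, without naming an open domain for it. *)
Definition field_near p X : Prop :=
  (\forall q \near p, tangent q (X q)) /\
  (forall f, smooth_at p f -> smooth_at p (fun q => X q f)).

Lemma field_near_tangent p X : field_near p X -> tangent p (X p).
Proof. by move=> [/nbhs_singleton]. Qed.

Lemma vector_field_near (V : set M) p X :
  open V -> V p -> vector_field V X -> field_near p X.
Proof.
move=> oV Vp /(smooth_alongP X (fun x A nA => nA) oV) XV; split=> [|f sf].
  by apply/nbhs_openP; exists V; split=> // q /XV[].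
by have [_] := XV p Vp; exact.
Qed.

Lemma vector_fieldP (V : set M) X : open V ->
  vector_field V X <-> forall p, V p -> field_near p X.
Proof.
move=> oV; split=> [VX p Vp|H]; first exact: vector_field_near VX.
apply/(smooth_alongP X (fun x A nA => nA) oV) => p Vp.
by have XV := H p Vp; split; [exact: field_near_tangent|have [] := XV].
Qed.

Lemma field_near_chart_derivation c a p : atlas c -> cdom c p ->
  field_near p (fun q => chart_derivation c q a).
Proof.
move=> ac cp; split=> [|f]; last exact: smooth_at_chart_derivation.
by apply: filterS (cdom_nbhs cp) => q cq; exact: tangent_chart_derivation.
Qed.

Lemma field_near_dcoord c i p : atlas c -> cdom c p -> field_near p (dcoord c i).
Proof. exact: field_near_chart_derivation. Qed.

Lemma field_near_expand c p X f : atlas c -> cdom c p -> field_near p X -> smooth_at p f ->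
  \forall q \near p, X q f = \sum_i X q (coord c i) * dcoord c i q f.
Proof.
move=> ac cp [tX sX] sf.
apply: filterS3 (cdom_nbhs cp) tX (smooth_at_near sf) => q cq tq sq.
exact: tangent_expand.
Qed.

Lemma lie_bracketE X Y p f : smooth_at p f ->
  lie_bracket X Y p f = X p (fun q => Y q f) - Y p (fun q => X q f).
Proof. by move=> sf; rewrite /lie_bracket asboolT. Qed.

(** The Leibniz rule for X = sum_i al_i B_i and Y = sum_j be_j B_j. The [B i] may be dependent and
    need not commute, so the formula serves both for coordinate fields and for the right-invariant
    fields of the U d_i. *)
Lemma bracket_expand n p X Y (B : 'I_n -> M -> functional R M) (al be : 'I_n -> M -> R) f :
  tangent p (X p) -> tangent p (Y p) -> (forall i, field_near p (B i)) ->
  (forall i, smooth_at p (al i)) -> (forall i, smooth_at p (be i)) -> smooth_at p f ->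
  (forall g, smooth_at p g -> \forall q \near p, X q g = \sum_i al i q * B i q g) ->
  (forall g, smooth_at p g -> \forall q \near p, Y q g = \sum_i be i q * B i q g) ->
  X p (fun q => Y q f) - Y p (fun q => X q f) =
  \sum_i \sum_j al i p * be j p *
    (B i p (fun q => B j q f) - B j p (fun q => B i q f)) +
  \sum_j (X p (be j) - Y p (al j)) * B j p f.
Proof.
move=> tX tY BF sal sbe sf XE YE.
have sB j : smooth_at p (fun q => B j q f) by have [_] := BF j; exact.
rewrite (tangent_eq tX (YE f sf)) (tangent_eq tY (XE f sf)).
rewrite (tangent_sum _ tX); last by move=> i; exact: smooth_atM.
rewrite (tangent_sum _ tY); last by move=> i; exact: smooth_atM.
have -> : \sum_i X p (fun q => be i q * B i q f) =
  \sum_j (\sum_i al i p * be j p * B i p (fun q => B j q f) + X p (be j) * B j p f).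
  apply: eq_bigr => j _; rewrite (tangentM tX) // [B j p f * _]mulrC; congr (_ + _).
  by rewrite (nbhs_singleton (XE _ (sB j))) mulr_sumr; apply: eq_bigr => i _; ring.
have -> : \sum_i Y p (fun q => al i q * B i q f) =
  \sum_j (\sum_i al j p * be i p * B i p (fun q => B j q f) + Y p (al j) * B j p f).
  apply: eq_bigr => j _; rewrite (tangentM tY) // [B j p f * _]mulrC; congr (_ + _).
  by rewrite (nbhs_singleton (YE _ (sB j))) mulr_sumr; apply: eq_bigr => i _; ring.
rewrite !big_split /= exchange_big /= opprD addrACA -!sumrB; congr (_ + _).
  by apply: eq_bigr => i _; rewrite -sumrB; apply: eq_bigr => j _; ring.
by apply: eq_bigr => j _; ring.
Qed.

Lemma tangent_lie_bracket p X Y : field_near p X -> field_near p Y ->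
  tangent p (lie_bracket X Y p).
Proof.
move=> FX FY; have [c ac cp] := atlas_cover p.
apply: (@tangent_intro _ _ _ c p _ (fun j => X p (fun q => Y q (coord c j)) -
   Y p (fun q => X q (coord c j)))) => // f; last first.
  by move=> nsf; rewrite /lie_bracket asboolF.
move=> sf; rewrite lie_bracketE //.
have sc i := smooth_at_coord i ac cp.
rewrite (@bracket_expand _ p X Y (dcoord c) (fun i q => X q (coord c i))
   (fun i q => Y q (coord c i))) //.
(* The second-order terms vanish because coordinate fields commute. *)
- rewrite big1 ?add0r // => i _; rewrite big1 // => j _.
  by rewrite (dcoord_schwarz i j ac cp sf) subrr mulr0.
- exact: field_near_tangent.
- exact: field_near_tangent.
- by move=> i; exact: field_near_dcoord.
- by move=> i; have [_] := FX; apply.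
- by move=> i; have [_] := FY; apply.
- by move=> g sg; exact: field_near_expand.
- by move=> g sg; exact: field_near_expand.
Qed.

Lemma lie_bracket_near p X Y X' Y' : tangent p (X p) -> tangent p (Y p) ->
  (\forall q \near p, X q = X' q) -> (\forall q \near p, Y q = Y' q) ->
  lie_bracket X Y p = lie_bracket X' Y' p.
Proof.
move=> tX tY XX YY; apply/funext => f; rewrite /lie_bracket; case: ifP => // _.
rewrite -(nbhs_singleton XX) -(nbhs_singleton YY).
by congr (_ - _); [apply: (tangent_eq tX); apply: filterS YY => q ->|
  apply: (tangent_eq tY); apply: filterS XX => q ->].
Qed.

Lemma lie_bracket_anti p X Y : lie_bracket Y X p = - lie_bracket X Y p.
Proof.
apply/funext => f; rewrite -[RHS]/(- (lie_bracket X Y p f)) /lie_bracket.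
by case: ifP => _; rewrite ?oppr0 // opprB.
Qed.

End Fields.

(** * Right translations *)

Section Submersions.
Context {R : realType} {k m : nat} {G : manifold R k} {M : manifold R m}.

(** In charts around [h] and [s h], the difference [e1 - e2] is constant on the level set of [s], so
    [derive_level_set] applies; its surjectivity hypothesis is the submersion property. *)
Lemma submersion_level_eq (s : G -> M) (h : G) v (e1 e2 : G -> R) :
  submersion s -> tangent h v -> dmap s h v = 0 ->
  smooth_at h e1 -> smooth_at h e2 ->
  (\forall q \near h, s q = s h -> e1 q = e2 q) -> v e1 = v e2.
Proof.
move=> [ss surj] tv v0 se1 se2 e12; have [cs _] := ss.
have [c [a [ac ch vE]]] := tv; have [d ad dh] := atlas_cover (s h).
pose E q := e1 q - e2 q; have sE : smooth_at h E by exact: smooth_atB.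
have sd i : smooth_at h (coord d i \o s) by exact: smooth_at_smooth_map ss (smooth_at_coord i ad dh).
pose sg (y : 'rV[R]_k) : 'rV[R]_m := cmap d (s (cinv c y)).
have sgE i : (fun y => sg y 0 i) = (coord d i \o s) \o cinv c by [].
have ssg i : smooth_near (cmap c h) (fun y => sg y 0 i) by rewrite sgE; exact/smooth_atP.
have ssE : smooth_near (cmap c h) (E \o cinv c) by exact/smooth_atP.
have nd : \forall q \near h, cdom d (s q) by exact: cs (cdom_nbhs dh).
have /nbhs_openP[W [oW Wx WP]] : \forall y \near cmap c h,
    [/\ forall i, smooth_in [set y] (fun y => sg y 0 i), smooth_in [set y] (E \o cinv c),
        cdom d (s (cinv c y)) & (s (cinv c y) = s h -> e1 (cinv c y) = e2 (cinv c y))].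
  have H1 : \forall y \near cmap c h, forall i, smooth_in [set y] (fun y => sg y 0 i).
    apply: (@filter_forall _ _ (fun i (y : 'rV[R]_k) => smooth_in [set y] (fun y => sg y 0 i))
       (nbhs (cmap c h))) => i.
    exact/smooth_nearP.
  have H2 : \forall y \near cmap c h, smooth_in [set y] (E \o cinv c) by exact/smooth_nearP.
  have H3 : \forall q \near h, cdom d (s q) /\ (s q = s h -> e1 q = e2 q) by apply: filterI.
  by apply: filterS3 H1 H2 (near_cinv ch H3) => y ? ? [].
have D_sg b i : 'D_b (fun y => sg y 0 i) (cmap c h) = chart_derivation c h b (coord d i \o s).
  by rewrite chart_derivationE.
have := @derive_level_set R k m W sg (E \o cinv c) (cmap c h) a oW Wx.
have -> : 'D_a (E \o cinv c) (cmap c h) = v e1 - v e2.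
  by rewrite -(tangentB tv) // vE chart_derivationE.
move=> /(_ _ _ _ _ _)/eqP; rewrite subr_eq0 => H; apply/eqP/H.
- by move=> i; apply: Ck_pointwise => y /WP[/(_ i)/(_ 1%N)].
- by apply: Ck_pointwise => y /WP[_ /(_ 1%N)].
- move=> b; have [w tw wE] := surj h _ (tangent_chart_derivation b ad dh).
  exists (\row_i w (coord c i)) => i; rewrite D_sg -(tangent_chart ac ch tw).
  by rewrite -(chart_derivation_coord b i ad dh) -wE dmapE //; exact: smooth_at_coord.
- move=> i; rewrite D_sg -vE; have := congr1 (@^~ (coord d i)) v0.
  by rewrite dmapE //; exact: smooth_at_coord.
- move=> y /WP[_ _ dy ey]; rewrite /sg cmapKp // => sy.
  have shE : s (cinv c y) = s h by rewrite -(cmapKp dy) sy cmapKp.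
  by rewrite /= /E cmapKp // ey // subrr (nbhs_singleton e12) // subrr.
Qed.

End Submersions.

Section RightTranslations.
Context {R : realType} {k m : nat} {G : manifold R k} {M : manifold R m}.
Variable GM : lie_groupoid G M.
Implicit Types (g h q : G) (x : M) (f e : G -> R).
Local Notation s := (src GM).
Local Notation t := (tgt GM).
Local Notation u := (gunit GM).
Local Notation "g ** h" := (gmul GM g h) (at level 40, left associativity).

Let ss : smooth_map s := proj1 (src_submersion GM).
Let st : smooth_map t := proj1 (tgt_submersion GM).
Let su : smooth_map u := gunit_smooth GM.

Definition vertical h v : Prop := tangent h v /\ dmap s h v = 0.

Lemma mul_unit_tgt g : u (t g) ** g = g. Proof. exact: gmul1g. Qed.

Lemma src_unit_tgt g : s (u (t g)) = t g. Proof. exact: src_unit. Qed.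

Lemma smooth_at_row_mx (P : G -> G) (Q : G -> G) a b g i : atlas a -> atlas b ->
  cdom a (P g) -> cdom b (Q g) ->
  (forall f, smooth_at (P g) f -> smooth_at g (f \o P)) ->
  (forall f, smooth_at (Q g) f -> smooth_at g (f \o Q)) ->
  smooth_at g (fun q => row_mx (cmap a (P q)) (cmap b (Q q)) 0 i).
Proof.
move=> aa ab aP bQ sP sQ.
rewrite (_ : (fun q => _) = (fun q => match fintype.split i with
  inl j => coord a j (P q) | inr j => coord b j (Q q) end)); last first.
  by apply/funext => q; rewrite mxE.
by case: (fintype.split i) => j; [apply: (sP (coord a j))|apply: (sQ (coord b j))]; exact: smooth_at_coord.
Qed.

Lemma smooth_at_row_mxl a g (z : 'rV[R]_k) i : atlas a -> cdom a g ->
  smooth_at g (fun q => row_mx (cmap a q) z 0 i).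
Proof.
move=> aa ag; rewrite (_ : (fun q => _) = (fun q => match fintype.split i with
  inl j => coord a j q | inr j => cst (z 0 j) q end)); last first.
  by apply/funext => q; rewrite mxE.
by case: (fintype.split i) => j; [exact: smooth_at_coord|exact: smooth_at_cst].
Qed.

Lemma mul_charts g h : s g = t h -> exists a b c W (F : 'rV[R]_(k + k) -> 'rV[R]_k),
  [/\ [/\ atlas a, atlas b & atlas c], [/\ cdom a g, cdom b h & cdom c (g ** h)],
      open W /\ W (row_mx (cmap a g) (cmap b h)),
      forall z i, W z -> smooth_near z (fun y => F y 0 i)
    & forall g' h', cdom a g' -> cdom b h' -> s g' = t h' ->
        W (row_mx (cmap a g') (cmap b h')) ->
        cdom c (g' ** h') /\ cmap c (g' ** h') = F (row_mx (cmap a g') (cmap b h'))].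
Proof.
move=> gh; have [a [b [c [W [F [[aa ab ac] [ag bh] [oW Wz] sF FE]]]]]] := gmul_smooth gh.
have [cgh _] := FE g h ag bh gh Wz.
exists a, b, c, W, F; split=> // z i Wz'.
by apply: smooth_near_in (sF i); exact: open_nbhs_nbhs.
Qed.

(** Products are meaningful only for composable pairs, so the continuity of R_g is stated along the
    source fiber. *)
Lemma near_mul h g (P : set G) : s h = t g -> nbhs (h ** g) P ->
  \forall q \near h, s q = t g -> P (q ** g).
Proof.
move=> hg nP.
have [a [b [c [W [F [[aa ab ac] [ah bg chg] [oW Wz] sF FE]]]]]] := mul_charts hg.
pose w q := row_mx (cmap a q) (cmap b g).
have cw : {for h, continuous w}.
  by apply: continuous_smooth_at => i; exact: smooth_at_row_mxl.
have [_ Fz] := FE h g ah bg hg Wz.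
have cF : {for w h, continuous F}.
  by apply: continuous_rV => i; exact: smooth_near_continuous (sF _ i Wz).
have nP' : \forall y \near F (w h), P (cinv c y) by rewrite -Fz; exact: near_cinv.
have H1 : \forall q \near h, P (cinv c (F (w q))).
  exact: cw (cF _ nP').
have H2 : \forall q \near h, W (w q) by exact: cw (open_nbhs_nbhs (conj oW Wz)).
apply: filterS3 (cdom_nbhs ah) H1 H2 => q aq Pq Wq qg.
by have [cq Fq] := FE q g aq bg qg Wq; rewrite -(cmapKp cq) Fq.
Qed.

(** [H] extends [f (h' ** g')] off the composable pairs. Both factors are kept variable, since the
    smoothness of right-invariant fields requires [g'] to move as well. *)
Lemma mul_ext h g f : s h = t g -> smooth_at (h ** g) f ->
  exists a b W (H : 'rV[R]_(k + k) -> R),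
  [/\ [/\ atlas a, atlas b, cdom a h & cdom b g],
      open W /\ W (row_mx (cmap a h) (cmap b g)),
      forall z, W z -> smooth_near z H
    & forall h' g', cdom a h' -> cdom b g' -> s h' = t g' ->
        W (row_mx (cmap a h') (cmap b g')) ->
        H (row_mx (cmap a h') (cmap b g')) = f (h' ** g')].
Proof.
move=> hg sf.
have [a [b [c [W [F [[aa ab ac] [ah bg chg] [oW Wz] sF FE]]]]]] := mul_charts hg.
have [_ Fz] := FE h g ah bg hg Wz.
have sH : smooth_near (row_mx (cmap a h) (cmap b g)) ((f \o cinv c) \o F).
  apply: smooth_near_comp => [|i]; last exact: sF.
  by rewrite -Fz; exact/smooth_atP.
have /nbhs_openP[W' [oW' W'z W'H]] : \forall z \near row_mx (cmap a h) (cmap b g),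
    W z /\ smooth_near z ((f \o cinv c) \o F).
  by apply: filterI (smooth_near_near sH); exact: open_nbhs_nbhs.
exists a, b, W', ((f \o cinv c) \o F); split=> // [z /W'H[]//|h' g' ah' bg' hg' /W'H[Wz' _]].
by have [ch Fh] := FE h' g' ah' bg' hg' Wz'; rewrite /= -Fh cmapKp.
Qed.

Lemma dright_ext h g f : s h = t g -> smooth_at (h ** g) f ->
  exists2 e, smooth_at h e & \forall q \near h, s q = t g -> e q = f (q ** g).
Proof.
move=> hg sf; have [a [b [W [H [[aa ab ah bg] [oW Wz] sH HE]]]]] := mul_ext hg sf.
pose w q := row_mx (cmap a q) (cmap b g).
have sw i : smooth_at h (fun q => w q 0 i) by exact: smooth_at_row_mxl.
exists (H \o w); first by apply: smooth_at_comp => //; exact: sH.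
have H2 : \forall q \near h, W (w q).
  exact: (continuous_smooth_at sw) (open_nbhs_nbhs (conj oW Wz)).
by apply: filterS2 (cdom_nbhs ah) H2 => q aq Wq qg /=; rewrite HE.
Qed.

Lemma drightE h g v f e : vertical h v -> s h = t g ->
  smooth_at (h ** g) f -> smooth_at h e ->
  (\forall q \near h, s q = t g -> e q = f (q ** g)) ->
  dright GM g h v f = v e.
Proof.
move=> [tv v0] hg sf se eE; rewrite /dright /dmap_within asboolT //.
(* [e] witnesses that an extension exists, so the default value of [xget] does not occur. *)
case: xgetP => [e' -> [se' e'E]|/(_ e)[]//].
apply: (submersion_level_eq (src_submersion GM) tv v0) => //.
by apply: filterS2 eE e'E => q eq e'q qh; rewrite eq ?e'q -?hg.
Qed.

Lemma dright_junk h g v f : ~ smooth_at (h ** g) f -> dright GM g h v f = 0.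
Proof. by move=> nsf; rewrite /dright /dmap_within asboolF. Qed.

Lemma dright_lin h g (a : R) v w :
  dright GM g h (a *: v + w) = a *: dright GM g h v + dright GM g h w.
Proof.
apply/funext => f; rewrite /dright /dmap_within.
rewrite -[RHS]/(a * (if _ then _ else _) + (if _ then _ else _)).
by case: ifP => // _; rewrite mulr0 addr0.
Qed.

Lemma dright_tangent h g v : vertical h v -> s h = t g -> tangent (h ** g) (dright GM g h v).
Proof.
move=> vv hg.
have [a [b [c [W [F [[aa ab ac] [ah bg chg] [oW Wz] sF FE]]]]]] := mul_charts hg.
have [_ Fz] := FE h g ah bg hg Wz.
pose w q := row_mx (cmap a q) (cmap b g).
have sw i : smooth_at h (fun q => w q 0 i) by exact: smooth_at_row_mxl.
have sFw i : smooth_at h (fun q => F (w q) 0 i).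
  exact: (@smooth_at_comp _ _ _ _ _ (fun y => F y 0 i) w (sF _ i Wz)).
apply: (@tangent_push _ _ _ _ _ c h (h ** g) v (F \o w)) => //; first by have [] := vv.
  move=> f sf; apply: drightE => //.
    by apply: smooth_at_comp => //=; rewrite -Fz; exact/smooth_atP.
  have H2 : \forall q \near h, W (w q).
    exact: (continuous_smooth_at sw) (open_nbhs_nbhs (conj oW Wz)).
  apply: filterS2 (cdom_nbhs ah) H2 => q aq Wq qg /=.
  by have [cq Fq] := FE q g aq bg qg Wq; rewrite -Fq cmapKp.
by move=> f; exact: dright_junk.
Qed.

Lemma dmap_tgt_dright h g v : vertical h v -> s h = t g ->
  dmap t (h ** g) (dright GM g h v) = dmap t h v.
Proof.
move=> vv hg; apply/funext => f; rewrite /dmap tgt_mul //; case: asboolP => // sf.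
have sft : smooth_at h (f \o t) by exact: smooth_at_smooth_map st sf.
apply: drightE => //.
  by apply: (smooth_at_smooth_map st); rewrite tgt_mul.
by apply: nearW => q qg /=; rewrite tgt_mul.
Qed.

Lemma dright_vertical h g v : vertical h v -> s h = t g -> vertical (h ** g) (dright GM g h v).
Proof.
move=> vv hg; split; first exact: dright_tangent.
apply/funext => f; rewrite /dmap; case: asboolP => // sf.
have [tv v0] := vv.
rewrite (drightE (e := cst (f (s g))) vv hg); first by rewrite (tangent_cst _ tv).
- exact: smooth_at_smooth_map ss sf.
- exact: smooth_at_cst.
- by apply: nearW => q qg /=; rewrite src_mul.
Qed.

(** If [e1] extends f o R_g' and [e2] extends e1 o R_g, then [e2] also extends f o R_(g g'), so both
    sides are the value of [v] on [e2]. *)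
Lemma dright_mul h g g' v : vertical h v -> s h = t g -> s g = t g' ->
  dright GM g' (h ** g) (dright GM g h v) = dright GM (g ** g') h v.
Proof.
move=> vv hg gg'; have vd := dright_vertical vv hg.
have hgg' : s h = t (g ** g') by rewrite tgt_mul.
have hgg : s (h ** g) = t g' by rewrite src_mul.
apply/funext => f; have [sf|nsf] := pselect (smooth_at (h ** g ** g') f); last first.
  by rewrite !dright_junk // gmulA.
have [e1 se1 e1E] := dright_ext hgg sf.
have [e2 se2 e2E] := dright_ext hg se1.
rewrite (drightE vd hgg sf se1 e1E) (drightE vv hg se1 se2 e2E).
rewrite (drightE (e := e2) vv hgg') //; first by rewrite gmulA.
apply: filterS2 e2E (near_mul hg e1E) => q e2q e1q.
by rewrite tgt_mul // => qg; rewrite e2q // e1q ?src_mul // gmulA.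
Qed.

Lemma dright_unit h v : vertical h v -> dright GM (u (s h)) h v = v.
Proof.
move=> vv; have hu : s h = t (u (s h)) by rewrite tgt_unit.
have [tv v0] := vv.
apply: (@tangent_ext _ _ _ h) => //.
  by have := dright_tangent vv hu; rewrite gmulg1.
move=> f sf; apply: drightE => //; first by rewrite gmulg1.
by apply: nearW => q; rewrite tgt_unit => <-; rewrite gmulg1.
Qed.

Lemma vertical_lin h (a : R) v w : vertical h v -> vertical h w -> vertical h (a *: v + w).
Proof.
move=> [tv v0] [tw w0]; split; first exact: tangent_lin.
by rewrite dmap_lin v0 w0 scaler0 addr0.
Qed.

Lemma dright_surj g w : vertical g w -> exists2 v, vertical (u (t g)) v &
  dright GM g (u (t g)) v = w.
Proof.
move=> vw; have gi : s g = t (ginv GM g) by rewrite tgt_inv.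
have vi := dright_vertical vw gi; rewrite gmulgV in vi.
exists (dright GM (ginv GM g) g w) => //.
by rewrite -(gmulgV GM g) dright_mul // ?src_inv // gmulVg dright_unit.
Qed.

Lemma dright_inj g v w : vertical (u (t g)) v -> vertical (u (t g)) w ->
  dright GM g (u (t g)) v = dright GM g (u (t g)) w -> v = w.
Proof.
have gi : s g = t (ginv GM g) by rewrite tgt_inv.
have K z : vertical (u (t g)) z -> dright GM (ginv GM g) g (dright GM g (u (t g)) z) = z.
  move=> vz; rewrite -{2}(mul_unit_tgt g) dright_mul ?src_unit // gmulgV.
  by have := dright_unit vz; rewrite src_unit.
by move=> vv vw E; rewrite -(K v vv) E K.
Qed.

Definition section_near x (a : M -> functional R G) : Prop :=
  (\forall y \near x, vertical (u y) (a y)) /\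
  (forall f, smooth_at (u x) f -> smooth_at x (fun y => a y f)).

Local Notation ri := (right_invariant GM).

Lemma right_invariant_unit x a : vertical (u x) (a x) -> ri a (u x) = a x.
Proof.
move=> vx; rewrite /right_invariant tgt_unit.
by have := dright_unit vx; rewrite src_unit.
Qed.

Lemma right_invariant_vertical g a : vertical (u (t g)) (a (t g)) -> vertical g (ri a g).
Proof.
move=> vt; have := dright_vertical vt (src_unit_tgt g).
by rewrite mul_unit_tgt.
Qed.

Lemma near_tgt g (P : set M) : nbhs (t g) P -> \forall q \near g, P (t q).
Proof. by have [ct _] := st => nP; exact: ct nP. Qed.

Lemma near_unit x (P : set G) : nbhs (u x) P -> \forall y \near x, P (u y).
Proof. by have [cu _] := su => nP; exact: cu nP. Qed.

(** The value at [q] is the sum over [j] of [a (t q) (coord c j)] times a partial derivative of [H]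
    at the pair (u (t q), q), hence smooth in [q]. Only the first factor is differentiated, whence
    [lshift]. *)
Lemma smooth_at_right_invariant g a f : section_near (t g) a -> smooth_at g f ->
  smooth_at g (fun q => ri a q f).
Proof.
move=> [va sa] sf.
have sf1 : smooth_at (u (t g) ** g) f by rewrite mul_unit_tgt.
have [c [b [W [H [[ac ab cu bg] [oW Wz] sH HE]]]]] := mul_ext (src_unit_tgt g) sf1.
have sut f' : smooth_at (u (t g)) f' -> smooth_at g (f' \o (u \o t)).
  move=> sf'; apply: (smooth_at_smooth_map (f := f' \o u) st).
  exact: (smooth_at_smooth_map su).
pose z q := row_mx (cmap c (u (t q))) (cmap b q).
have sz i : smooth_at g (fun q => z q 0 i).
  exact: (@smooth_at_row_mx (u \o t) id).
apply: (@smooth_at_eq _ _ _ _ (fun q => \sum_j a (t q) (coord c j) *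
  'D_(delta_mx 0 (lshift k j)) H (z q))); last first.
  apply: smooth_at_sum => j; apply: smooth_atM.
    by apply: (smooth_at_smooth_map st (f := fun y => a y (coord c j))); apply: sa; exact: smooth_at_coord.
  apply: (@smooth_at_comp _ _ _ _ _ (fun y => 'D_(delta_mx 0 (lshift k j)) H y) z) => //.
  by apply: smooth_near_derive; exact: sH.
have nu : \forall y \near t g, vertical (u y) (a y) /\ cdom c (u y).
  by apply: filterI va _; apply: near_unit; exact: cdom_nbhs.
have H1 : \forall q \near g, (vertical (u (t q)) (a (t q)) /\ cdom c (u (t q))) /\ cdom b q.
  by apply: filterI (cdom_nbhs bg); exact: near_tgt nu.
have H2 : \forall q \near g, W (z q).
  exact: (continuous_smooth_at sz) (open_nbhs_nbhs (conj oW Wz)).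
apply: filterS3 H1 H2 (smooth_at_near sf) => q [[vq cq] bq] Wq sq.
pose w l := row_mx (cmap c l) (cmap b q).
have sw i : smooth_at (u (t q)) (fun l => w l 0 i) by exact: smooth_at_row_mxl.
have sHw : smooth_at (u (t q)) (H \o w) by apply: smooth_at_comp => //; exact: sH.
rewrite /right_invariant (drightE (e := H \o w) vq (src_unit_tgt q)) //; last 2 first.
  by rewrite mul_unit_tgt.
  have H3 : \forall l \near u (t q), W (w l).
    exact: (continuous_smooth_at sw) (open_nbhs_nbhs (conj oW Wq)).
  by apply: filterS2 (cdom_nbhs cq) H3 => l cl Wl lq /=; rewrite HE.
have [tq _] := vq.
rewrite (tangent_comp tq) //; last exact: sH.
(* The second block of [w] is frozen at [q], so its partial derivatives contribute nothing. *)
rewrite big_split_ord /= [X in _ + X]big1 ?addr0 => [|j _]; last first.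
  have -> : (fun l => w l 0 (rshift k j)) = cst (cmap b q 0 j).
    by apply/funext => l; rewrite /w row_mxEr.
  by rewrite (tangent_cst _ tq) mul0r.
apply: eq_bigr => j _; congr (a (t q) _ * _).
by apply/funext => l; rewrite /w row_mxEl.
Qed.

Lemma field_near_right_invariant g a : section_near (t g) a -> field_near g (ri a).
Proof.
move=> sa; split=> [|f sf]; last exact: smooth_at_right_invariant.
have [va _] := sa; apply: filterS (near_tgt va) => q vq.
by have [] := right_invariant_vertical vq.
Qed.

Lemma dmap_tgt_right_invariant g a : vertical (u (t g)) (a (t g)) ->
  dmap t g (ri a g) = dmap t (u (t g)) (a (t g)).
Proof.
move=> vt; rewrite -[in LHS](mul_unit_tgt g) /right_invariant.
rewrite (_ : t (u (t g) ** g) = t g); last by rewrite mul_unit_tgt.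
by rewrite [X in dright _ X]mul_unit_tgt dmap_tgt_dright ?src_unit.
Qed.

(* e is f o R_g near the unit, extended off the source fiber *)
Lemma right_invariant_ext g f : smooth_at g f -> exists e,
  [/\ smooth_at (u (t g)) e,
      forall w, vertical (u (t g)) w -> dright GM g (u (t g)) w f = w e,
      forall a, section_near (t g) a -> ri a g f = ri a (u (t g)) e
    & forall a b, section_near (t g) a -> section_near (t g) b ->
        ri a g (fun q => ri b q f) = ri a (u (t g)) (fun q => ri b q e)].
Proof.
move=> sf; have sf1 : smooth_at (u (t g) ** g) f by rewrite mul_unit_tgt.
have [e se eE] := dright_ext (src_unit_tgt g) sf1.
have dE w : vertical (u (t g)) w -> dright GM g (u (t g)) w f = w e.
  by move=> vw; exact: drightE (src_unit_tgt g) sf1 se eE.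
exists e; split=> // [a [/nbhs_singleton va _]|a b sa sb].
  by rewrite right_invariant_unit // -dE.
have [/nbhs_singleton va _] := sa; have [vb _] := sb.
have sb1 : section_near (t (u (t g))) b by rewrite tgt_unit.
rewrite right_invariant_unit // /right_invariant -/(ri b).
apply: (drightE va (src_unit_tgt g)).
- by rewrite mul_unit_tgt; exact: smooth_at_right_invariant.
- exact: smooth_at_right_invariant.
have vb1 : \forall q \near u (t g), vertical (u (t q)) (b (t q)).
  by apply: (@near_tgt (u (t g)) [set y | vertical (u y) (b y)]); rewrite tgt_unit.
(* [ri b q] acts on germs at [q], so the equation for [e] is needed around every [q] near the
   unit. *)
have eEn : \forall q \near u (t g), \forall q' \near q, s q' = t g -> e q' = f (q' ** g).
  by move: eE => /nbhs_openP[V [oV Vu VE]]; apply/nbhs_openP; exists V; split=> // q Vq;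
    apply/nbhs_openP; exists V.
have sfn := near_mul (src_unit_tgt g) (smooth_at_near sf1).
have vb2 : \forall q \near u (t g), vertical (u (t q)) (b (t q)) /\
    \forall q' \near q, s q' = t g -> e q' = f (q' ** g) by apply: filterI.
apply: filterS3 vb2 sfn (smooth_at_near se) => q [vq eq] sq seq qg.
have vr := right_invariant_vertical vq.
rewrite -/(ri b q) -(drightE vr qg (sq qg) seq eq) /right_invariant tgt_mul //.
(* Right-invariance: the value of [ri b] at [q ** g] is the translate of its value at [q]. *)
by have := dright_mul vq (src_unit_tgt q) qg; rewrite mul_unit_tgt => ->.
Qed.

End RightTranslations.

(** * The curvature of a bundle map TM -> A *)

Section TwoVectors.
Context {R : realType} {m r : nat} {P : manifold R r}.

(** [v] and [w] stand for X and Y with coefficients [al] and [be], and [d l j] for d_l of [n j]. By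
    the Leibniz rule the derivatives of [al] and [be] cancel against the last sum on the left; those
    of [n] remain, antisymmetrized. It is applied on G to the torsion and on M to the bracket of
    (TM)_N. *)
Lemma anchor_coef_identity (p : P) v w (al be : 'I_m -> P -> R) (n : 'I_m -> P -> R)
    (d : 'I_m -> 'I_m -> R) : tangent p v -> tangent p w ->
  (forall j, smooth_at p (al j)) -> (forall j, smooth_at p (be j)) ->
  (forall j, smooth_at p (n j)) ->
  (forall j, v (n j) = \sum_l al l p * d l j) ->
  (forall j, w (n j) = \sum_l be l p * d l j) ->
  w (fun q => \sum_j al j q * n j q) - v (fun q => \sum_j be j q * n j q)
    + \sum_j (v (be j) - w (al j)) * n j p =
  - \sum_l \sum_j al l p * be j p * (d l j - d j l).
Proof.
move=> tv tw sal sbe sn vn wn.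
rewrite (tangent_sum _ tw); last by move=> i; exact: smooth_atM.
rewrite (tangent_sum _ tv); last by move=> i; exact: smooth_atM.
have -> : \sum_i w (fun q => al i q * n i q) =
   \sum_j \sum_l al j p * be l p * d l j + \sum_j w (al j) * n j p.
  rewrite -big_split; apply: eq_bigr => j _; rewrite (tangentM tw) // wn mulr_sumr.
  by rewrite [n j p * _]mulrC; congr (_ + _); apply: eq_bigr => l _; ring.
have -> : \sum_i v (fun q => be i q * n i q) =
   \sum_j \sum_l al l p * be j p * d l j + \sum_j v (be j) * n j p.
  rewrite -big_split; apply: eq_bigr => j _; rewrite (tangentM tv) // vn mulr_sumr.
  by rewrite [n j p * _]mulrC; congr (_ + _); apply: eq_bigr => l _; ring.
have -> : \sum_j (v (be j) - w (al j)) * n j p =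
    \sum_j v (be j) * n j p - \sum_j w (al j) * n j p.
  by rewrite -sumrB; apply: eq_bigr => j _; ring.
have -> : \sum_l \sum_j al l p * be j p * (d l j - d j l) =
   \sum_j \sum_l al l p * be j p * d l j - \sum_j \sum_l al j p * be l p * d l j.
  rewrite [X in _ = X - _]exchange_big -sumrB; apply: eq_bigr => l _.
  by rewrite -sumrB; apply: eq_bigr => j _; ring.
ring.
Qed.

End TwoVectors.

Lemma sum_coef (R : realType) n (a c d e b : 'I_n -> R) :
  \sum_i a i * b i + (\sum_i c i * b i + (- (\sum_i d i * b i) - \sum_i e i * b i)) =
  \sum_i (a i + c i - d i - e i) * b i.
Proof.
rewrite -!sumrN -!big_split; apply: eq_bigr => i _ /=; ring.
Qed.

Lemma coef_cancel (R : realType) (a b c d z : R) :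
  a - b + z - (a - c) - (d - b) = c - d + z.
Proof. by ring. Qed.

Lemma torsion_double (V : zmodType) (a b c d : V) :
  a + a - (b + c) - (b + c) + (d + d) = a + d - b - c + (a + d - b - c).
Proof.
have E (x y : V) : x - y - y = x - y *+ 2 by rewrite mulr2n opprD addrA.
have -> : a + d - b - c + (a + d - b - c) = a *+ 2 + d *+ 2 - b *+ 2 - c *+ 2.
  by rewrite -mulr2n !mulrnBl mulrnDl.
rewrite E -[a + a]mulr2n -[d + d]mulr2n mulrnDl opprD.
move: (a *+ 2) (b *+ 2) (c *+ 2) (d *+ 2) => a2 b2 c2 d2.
by rewrite addrA [LHS]addrAC; congr (_ - _); exact: addrAC.
Qed.

Section Curvature.
Context {R : realType} {k m : nat} {G : manifold R k} {M : manifold R m}.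
Variable GM : lie_groupoid G M.
Variable U : M -> functional R M -> functional R G.
Hypothesis HU : @bundle_map R m M (tangent_bundle M) (groupoid_bundle GM) U.
Implicit Types (g h q : G) (x : M) (f e : G -> R) (c : chart R M m).
Local Notation s := (src GM).
Local Notation t := (tgt GM).
Local Notation u := (gunit GM).
Local Notation ri := (right_invariant GM).
Local Notation K := (right_tensor GM U).

Let st : smooth_map t := proj1 (tgt_submersion GM).
Let su : smooth_map u := gunit_smooth GM.

Definition anchored x : functional R M -> functional R M :=
  fun v => dmap t (u x) (U x v).

Definition image_section (X : M -> functional R M) : M -> functional R G :=
  fun x => U x (X x).

Local Notation N := anchored.
Local Notation US := image_section.

Lemma U_vertical x v : tangent x v -> vertical GM (u x) (U x v).
Proof. by case: HU => + _ _; exact. Qed.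

Lemma U_lin x (a : R) v w : tangent x v -> tangent x w ->
  U x (a *: v + w) = a *: U x v + U x w.
Proof. by case: HU => _ + _; exact. Qed.

Lemma U0 x : U x 0 = 0.
Proof.
have t0 := tangent0 x; have := U_lin 1 t0 t0.
rewrite !scale1r addr0 => /eqP; rewrite -subr_eq0 opprD addrA subrr sub0r oppr_eq0.
by move/eqP.
Qed.

Lemma U_sum x (a : 'I_m -> R) (v : 'I_m -> functional R M) : (forall i, tangent x (v i)) ->
  U x (\sum_i a i *: v i) = \sum_i a i *: U x (v i).
Proof.
move=> tv.
suff [] : tangent x (\sum_i a i *: v i) /\ U x (\sum_i a i *: v i) = \sum_i a i *: U x (v i) by [].
elim/big_rec2: _ => [|i w z _ [tz zE]]; first by split; [exact: tangent0|exact: U0].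
by split; [exact: tangent_lin|rewrite U_lin // zE].
Qed.

Lemma section_near_image (V : set M) X x : open V -> V x -> vector_field V X ->
  section_near GM x (US X).
Proof.
move=> oV Vx VX; have [cu _] := su; case: HU => _ _ /(_ V X oV VX) [VU _].
have [cX _] := VX; split; last by have [_] := (smooth_alongP _ cu oV).1 VU x Vx; exact.
apply/nbhs_openP; exists V; split=> // y Vy; apply: U_vertical; exact: cX.
Qed.

Lemma vector_field_dcoord c i : atlas c -> vector_field (cdom c) (dcoord c i).
Proof.
move=> ac; apply/vector_fieldP; first exact: cdom_open.
by move=> x cx; exact: field_near_dcoord.
Qed.

Lemma section_near_dcoord c i x : atlas c -> cdom c x -> section_near GM x (US (dcoord c i)).
Proof.
by move=> ac cx; apply: section_near_image (vector_field_dcoord i ac) => //; exact: cdom_open.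
Qed.

Lemma U_expand c x v : atlas c -> cdom c x -> tangent x v ->
  U x v = \sum_i v (coord c i) *: U x (dcoord c i x).
Proof.
move=> ac cx tv; rewrite {1}(tangent_dcoordE ac cx tv) U_sum // => i.
exact: tangent_dcoord.
Qed.

Lemma smooth_at_unit_tgt x (f : M -> R) : smooth_at x f -> smooth_at (t (u x)) f.
Proof. by rewrite tgt_unit. Qed.

Lemma anchoredE x v (f : M -> R) : smooth_at x f -> N x v f = U x v (f \o t).
Proof. by move=> sf; rewrite /anchored dmapE // tgt_unit. Qed.

Lemma anchored_tangent x v : tangent x v -> tangent x (N x v).
Proof.
by move=> /U_vertical[tv _]; have := dmap_tangent st tv; rewrite tgt_unit.
Qed.

Lemma anchored_lin x (a : R) v w : tangent x v -> tangent x w ->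
  N x (a *: v + w) = a *: N x v + N x w.
Proof. by move=> tv tw; rewrite /anchored U_lin // dmap_lin. Qed.

Lemma smooth_at_comp_tgt x (f : M -> R) : smooth_at x f -> smooth_at (u x) (f \o t).
Proof. by move=> sf; apply: (smooth_at_smooth_map st); exact: smooth_at_unit_tgt. Qed.

Lemma field_near_anchored (V : set M) X x : open V -> V x -> vector_field V X ->
  field_near x (tapp N X).
Proof.
move=> oV Vx VX; have [vX sX] := section_near_image oV Vx VX.
have [tX _] := VX; split.
  by apply/nbhs_openP; exists V; split=> // y Vy; apply: anchored_tangent; exact: tX.
move=> f sf; apply: (@smooth_at_eq _ _ _ _ (fun y => US X y (f \o t))).
  by apply: filterS (smooth_at_near sf) => y sy; rewrite /tapp anchoredE.
by apply: sX; exact: smooth_at_comp_tgt.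
Qed.

Lemma tangent_right_tensor g v : tangent g v -> tangent g (K g v).
Proof.
move=> tv; have := dright_tangent (U_vertical (dmap_tangent st tv)) (src_unit_tgt GM g).
by rewrite mul_unit_tgt.
Qed.

Lemma right_tensor_lin g (a : R) v w : tangent g v -> tangent g w ->
  K g (a *: v + w) = a *: K g v + K g w.
Proof.
move=> tv tw; rewrite /right_tensor dmap_lin U_lin ?dright_lin //; exact: dmap_tangent.
Qed.

Lemma dright0 g h : dright GM g h 0 = 0.
Proof. by apply/funext => f; rewrite /dright /dmap_within; case: ifP. Qed.

Lemma dright_sum g h (a : 'I_m -> R) (v : 'I_m -> functional R G) :
  dright GM g h (\sum_i a i *: v i) = \sum_i a i *: dright GM g h (v i).
Proof.
elim/big_rec2: _ => [|i w z _ zE]; first exact: dright0.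
by rewrite dright_lin zE.
Qed.

Lemma right_invariant_expand c g (v : functional R M) : atlas c -> cdom c (t g) ->
  tangent (t g) v ->
  dright GM g (u (t g)) (U (t g) v) = \sum_i v (coord c i) *: ri (US (dcoord c i)) g.
Proof.
by move=> ac cg tv; rewrite (U_expand ac cg tv) dright_sum.
Qed.

Lemma right_tensor_expand c g v f : atlas c -> cdom c (t g) -> tangent g v ->
  K g v f = \sum_i v (coord c i \o t) * ri (US (dcoord c i)) g f.
Proof.
move=> ac cg tv; rewrite /right_tensor.
rewrite (right_invariant_expand ac cg (dmap_tangent st tv)) fct_sumE.
by apply: eq_bigr => i _; rewrite dmapE //; exact: smooth_at_coord.
Qed.

Lemma smooth_at_coord_tgt c g i : atlas c -> cdom c (t g) -> smooth_at g (coord c i \o t).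
Proof. by move=> ac cg; apply: (smooth_at_smooth_map st); exact: smooth_at_coord. Qed.

Lemma near_cdom_tgt c g : cdom c (t g) -> \forall q \near g, cdom c (t q).
Proof. by move=> cg; apply: near_tgt; exact: cdom_nbhs. Qed.

Lemma field_near_dcoord_image c g i : atlas c -> cdom c (t g) ->
  field_near g (ri (US (dcoord c i))).
Proof. by move=> ac cg; apply: field_near_right_invariant; exact: section_near_dcoord. Qed.

Lemma field_near_right_tensor g X : field_near g X -> field_near g (tapp K X).
Proof.
move=> [tX sX]; split=> [|f sf].
  by apply: filterS tX => q; exact: tangent_right_tensor.
have [c ac cg] := atlas_cover (t g).
apply: (@smooth_at_eq _ _ _ _ (fun q => \sum_i X q (coord c i \o t) * ri (US (dcoord c i)) q f)).
  apply: filterS2 tX (near_cdom_tgt cg) => q tq cq.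
  by rewrite /tapp (right_tensor_expand _ ac cq tq).
apply: smooth_at_sum => i; apply: smooth_atM.
  by apply: sX; exact: smooth_at_coord_tgt.
by have [_] := field_near_dcoord_image i ac cg; exact.
Qed.

Definition anchor_coef c j i : M -> R := fun x => N x (dcoord c j x) (coord c i).

Lemma smooth_at_anchor_coef c j i x : atlas c -> cdom c x -> smooth_at x (anchor_coef c j i).
Proof.
move=> ac cx; have [_] := field_near_anchored (cdom_open c) cx (vector_field_dcoord j ac).
by apply; exact: smooth_at_coord.
Qed.

Lemma anchored_coord c x v i : atlas c -> cdom c x -> tangent x v ->
  N x v (coord c i) = \sum_j v (coord c j) * anchor_coef c j i x.
Proof.
move=> ac cx tv; have sc := smooth_at_coord i ac cx.
rewrite anchoredE // (U_expand ac cx tv) fct_sumE; apply: eq_bigr => j _.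
by rewrite /anchor_coef anchoredE.
Qed.

(* The components of [U d_l, U d_j]_A - U [d_l, d_j]_N, carried to g by right
   translation. *)
Definition curvature c l j g f : R :=
  ri (US (dcoord c l)) g (fun q => ri (US (dcoord c j)) q f)
  - ri (US (dcoord c j)) g (fun q => ri (US (dcoord c l)) q f)
  - \sum_i (dcoord c l (t g) (anchor_coef c j i) - dcoord c j (t g) (anchor_coef c l i))
           * ri (US (dcoord c i)) g f.

(** The derivatives of the matrix of N are taken at [t g], which is also the target of the unit
    [u (t g)]; the other factors are transported by [right_invariant_ext]. *)
Lemma curvature_right_invariant c g f : atlas c -> cdom c (t g) -> smooth_at g f ->
  exists2 e, smooth_at (u (t g)) e & forall l j, curvature c l j g f = curvature c l j (u (t g)) e.
Proof.
move=> ac cg sf; have [e [se _ e1 e2]] := right_invariant_ext GM sf.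
have sB i := section_near_dcoord i ac cg.
exists e => // l j; rewrite /curvature !e2 // tgt_unit; congr (_ - _).
by apply: eq_bigr => i _; rewrite e1.
Qed.

Lemma tangent_comp_tgt c g v (n : M -> R) : atlas c -> cdom c (t g) -> tangent g v ->
  smooth_at (t g) n -> v (n \o t) = \sum_l v (coord c l \o t) * dcoord c l (t g) n.
Proof.
move=> ac cg tv sn; have <- : dmap t g v n = v (n \o t) by exact: dmapE.
rewrite (tangent_expand ac cg (dmap_tangent st tv) sn).
by apply: eq_bigr => l _; rewrite dmapE //; exact: smooth_at_coord.
Qed.

Lemma right_invariant_coord_tgt c g j i : atlas c -> cdom c (t g) ->
  ri (US (dcoord c j)) g (coord c i \o t) = anchor_coef c j i (t g).
Proof.
move=> ac cg; have [va _] := section_near_dcoord j ac cg.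
have sc := smooth_at_coord i ac cg.
have := congr1 (@^~ (coord c i)) (dmap_tgt_right_invariant (nbhs_singleton va)).
by rewrite /= dmapE // => ->; rewrite dmapE ?tgt_unit // /anchor_coef anchoredE.
Qed.

Lemma torsion_expand c g X Y f : atlas c -> cdom c (t g) ->
  field_near g X -> field_near g Y -> smooth_at g f ->
  torsion K X Y g f =
  \sum_l \sum_j X g (coord c l \o t) * Y g (coord c j \o t) * curvature c l j g f.
Proof.
move=> ac cg FX FY sf.
have [FKX FKY] := (field_near_right_tensor FX, field_near_right_tensor FY).
have [tX tY] := (field_near_tangent FX, field_near_tangent FY).
have [tKX tKY] := (field_near_tangent FKX, field_near_tangent FKY).
pose B i := ri (US (dcoord c i)).
have FB i : field_near g (B i) by exact: field_near_dcoord_image.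
pose al i q := X q (coord c i \o t); pose be i q := Y q (coord c i \o t).
have sct i := smooth_at_coord_tgt i ac cg.
have sal i : smooth_at g (al i) by have [_] := FX; exact.
have sbe i : smooth_at g (be i) by have [_] := FY; exact.
have KE Z f' : field_near g Z -> \forall q \near g,
    tapp K Z q f' = \sum_i Z q (coord c i \o t) * B i q f'.
  move=> [tZ _]; apply: filterS2 tZ (near_cdom_tgt cg) => q tq cq.
  by rewrite /tapp (right_tensor_expand _ ac cq tq).
have Kc Z i : field_near g Z -> \forall q \near g,
    tapp K Z q (coord c i \o t) = \sum_j Z q (coord c j \o t) * (anchor_coef c j i \o t) q.
  move=> [tZ _]; apply: filterS2 tZ (near_cdom_tgt cg) => q tq cq.
  rewrite /tapp (right_tensor_expand _ ac cq tq); apply: eq_bigr => j _.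
  by rewrite right_invariant_coord_tgt.
have tXY := tangent_lie_bracket FX FY.
have tKXY := tangent_lie_bracket FKX FY.
have tXKY := tangent_lie_bracket FX FKY.
(* [K X] and [K Y] are combinations of the [B i] whose coefficients [al], [be] are computed from X
   and Y themselves. *)
have E1 := @bracket_expand _ _ _ _ g (tapp K X) (tapp K Y) B al be f tKX tKY FB sal sbe sf
  (fun f' _ => KE X f' FX) (fun f' _ => KE Y f' FY).
pose n i j := anchor_coef c j i \o t.
have sn i j : smooth_at g (n i j).
  by apply: (smooth_at_smooth_map st); exact: smooth_at_anchor_coef.
have E2 i := @anchor_coef_identity _ _ _ _ g (X g) (Y g) al be (n i)
  (fun l j => dcoord c l (t g) (anchor_coef c j i)) tX tY sal sbe (sn i)
  (fun j => tangent_comp_tgt ac cg tX (smooth_at_anchor_coef j i ac cg))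
  (fun j => tangent_comp_tgt ac cg tY (smooth_at_anchor_coef j i ac cg)).
have -> : torsion K X Y g f = lie_bracket (tapp K X) (tapp K Y) g f
  + K g (K g (lie_bracket X Y g)) f - K g (lie_bracket (tapp K X) Y g) f
  - K g (lie_bracket X (tapp K Y) g) f by [].
rewrite lie_bracketE // E1 !(right_tensor_expand _ ac cg) //; last exact: tangent_right_tensor.
have -> : \sum_l \sum_j X g (coord c l \o t) * Y g (coord c j \o t) * curvature c l j g f =
  \sum_l \sum_j al l g * be j g * (B l g (fun q => B j q f) - B j g (fun q => B l q f))
  + \sum_i - (\sum_l \sum_j al l g * be j g * (dcoord c l (t g) (anchor_coef c j i)
       - dcoord c j (t g) (anchor_coef c l i))) * B i g f.
  have -> : \sum_i - (\sum_l \sum_j al l g * be j g * (dcoord c l (t g) (anchor_coef c j i)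
       - dcoord c j (t g) (anchor_coef c l i))) * B i g f =
    - \sum_l \sum_j al l g * be j g * \sum_i ((dcoord c l (t g) (anchor_coef c j i)
       - dcoord c j (t g) (anchor_coef c l i)) * B i g f).
    rewrite -sumrN; under [RHS]eq_bigr do (rewrite -sumrN;
      under eq_bigr do rewrite mulr_sumr -sumrN; rewrite exchange_big).
    rewrite exchange_big; apply: eq_bigr => i _ /=.
    rewrite mulNr mulr_suml -sumrN; apply: eq_bigr => l _.
    by rewrite mulr_suml -sumrN; apply: eq_bigr => j _; rewrite !mulrA.
  rewrite -sumrB; apply: eq_bigr => l _; rewrite -sumrB; apply: eq_bigr => j _.
  by rewrite /curvature mulrBr.
rewrite -!addrA; congr (_ + _); rewrite sum_coef.
apply: eq_bigr => i _; congr (_ * _); rewrite -E2 !lie_bracketE //.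
rewrite (right_tensor_expand _ ac cg tXY).
have -> : \sum_j lie_bracket X Y g (coord c j \o t) * ri (US (dcoord c j)) g (coord c i \o t) =
    \sum_j (X g (be j) - Y g (al j)) * n i j g.
  by apply: eq_bigr => j _; rewrite lie_bracketE // right_invariant_coord_tgt.
(* The derivatives of [be i] along [K X] and of [al i] along [K Y] occur in the bracket of [K X] and
   [K Y] and again in the mixed brackets, and cancel; those along X and Y were handled by [E2]. *)
rewrite (tangent_eq tY (Kc X i FX)) (tangent_eq tX (Kc Y i FY)).
exact: coef_cancel.
Qed.

Lemma fn_bracketE g X Y : field_near g X -> field_near g Y ->
  fn_bracket K K X Y g = torsion K X Y g + torsion K X Y g.
Proof.
move=> FX FY.
have [FKX FKY] := (field_near_right_tensor FX, field_near_right_tensor FY).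
have tKXY := tangent_lie_bracket FKX FY.
have tXKY := tangent_lie_bracket FX FKY.
rewrite /fn_bracket /torsion (lie_bracket_anti _ (tapp K X) (tapp K Y)).
rewrite (lie_bracket_anti _ X (tapp K Y)) !opprK.
have -> : K g (lie_bracket (tapp K X) Y g + lie_bracket X (tapp K Y) g) =
   K g (lie_bracket (tapp K X) Y g) + K g (lie_bracket X (tapp K Y) g).
  by have := right_tensor_lin 1 tKXY tXKY; rewrite !scale1r.
exact: torsion_double.
Qed.

End Curvature.

(** * Linear systems with smooth coefficients *)

Section SmoothLinearAlgebra.
Context {R : realType} {r : nat} {P : manifold R r}.

Lemma smooth_at_det n (p : P) (A : P -> 'M[R]_n) :
  (forall i j, smooth_at p (fun q => A q i j)) -> smooth_at p (fun q => \det (A q)).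
Proof.
move=> sA; apply: smooth_at_sum => /= w; apply: smooth_atM; first exact: smooth_at_cst.
by apply: smooth_at_prod => i; exact: sA.
Qed.

Lemma smooth_at_adj n (p : P) (A : P -> 'M[R]_n) i j :
  (forall i j, smooth_at p (fun q => A q i j)) -> smooth_at p (fun q => (\adj (A q)) i j).
Proof.
move=> sA; rewrite (_ : (fun q => _) = (fun q => (-1) ^+ (j + i) * \det (row' j (col' i (A q))))).
  apply: smooth_atM; first exact: smooth_at_cst.
  apply: (@smooth_at_det _ p (fun q => row' j (col' i (A q)))) => a b.
  rewrite (_ : (fun q => _) = (fun q => A q (lift j a) (lift i b))); first exact: sA.
  by apply/funext => q; rewrite !mxE.
by apply/funext => q; rewrite mxE.
Qed.

Lemma smooth_at_mulmx n1 n2 n3 (p : P) (A : P -> 'M[R]_(n1, n2)) (B : P -> 'M[R]_(n2, n3)) i j :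
  (forall i j, smooth_at p (fun q => A q i j)) ->
  (forall i j, smooth_at p (fun q => B q i j)) ->
  smooth_at p (fun q => (A q *m B q) i j).
Proof.
move=> sA sB; rewrite (_ : (fun q => _) = (fun q => \sum_l A q i l * B q l j)).
  by apply: smooth_at_sum => l; exact: smooth_atM.
by apply/funext => q; rewrite mxE.
Qed.

(* Cramer's rule, for the square matrix A B' with B' a right inverse of A at p. *)
Lemma smooth_at_solve n l (p : P) (A : P -> 'M[R]_(n, l)) (b : P -> 'rV[R]_n) :
  (forall i j, smooth_at p (fun q => A q i j)) ->
  (forall v : 'rV[R]_n, v *m A p = 0 -> v = 0) ->
  (forall j, smooth_at p (fun q => (b q *m A q) 0 j)) ->
  forall i, smooth_at p (fun q => b q 0 i).
Proof.
move=> sA injA sbA i.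
have /row_freeP[B' AB] : row_free (A p) by apply: inj_row_free.
pose C q := A q *m B'.
have sB (a : 'I_l) (c : 'I_n) : smooth_at p (fun q : P => B' a c) by exact: smooth_at_cst.
have sC a c : smooth_at p (fun q => C q a c) by exact: (@smooth_at_mulmx _ _ _ p A (fun=> B')).
have detC : \det (C p) != 0 by rewrite /C AB det1 oner_eq0.
have sd := smooth_at_det sC.
have nd : \forall q \near p, \det (C q) != 0.
  have o0 : open [set z : R | z != 0] by exact: open_neq.
  exact: (smooth_at_continuous sd) (open_nbhs_nbhs (conj o0 detC)).
apply: (@smooth_at_eq _ _ _ _ (fun q => ((b q *m A q *m B') *m \adj (C q)) 0 i * (\det (C q))^-1)).
  apply: filterS nd => q dq.
  by rewrite -2!mulmxA (mulmxA (A q)) mul_mx_adj mul_mx_scalar mxE mulrAC mulfV ?mul1r.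
apply: smooth_atM; last exact: smooth_at_inv.
apply: (@smooth_at_mulmx _ _ _ p (fun q => b q *m A q *m B') (fun q => \adj (C q))).
  move=> a c; apply: (@smooth_at_mulmx _ _ _ p (fun q => b q *m A q) (fun=> B')) => //.
  by move=> a' c'; rewrite (ord1 a').
by move=> a c; exact: smooth_at_adj.
Qed.

End SmoothLinearAlgebra.

(** * The bracket of A compared with that of (TM)_N *)

Section AlgebroidBrackets.
Context {R : realType} {k m : nat} {G : manifold R k} {M : manifold R m}.
Variable GM : lie_groupoid G M.
Variable U : M -> functional R M -> functional R G.
Hypothesis HU : @bundle_map R m M (tangent_bundle M) (groupoid_bundle GM) U.
Implicit Types (g h q : G) (x : M) (f e : G -> R) (c : chart R M m).
Local Notation s := (src GM).
Local Notation t := (tgt GM).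
Local Notation u := (gunit GM).
Local Notation ri := (right_invariant GM).
Local Notation K := (right_tensor GM U).
Local Notation N := (anchored GM U).
Local Notation US := (image_section U).

Let st : smooth_map t := proj1 (tgt_submersion GM).
Let su : smooth_map u := gunit_smooth GM.

(** Convertible to the bracket of [nijenhuis_algebroid N']. *)
Definition nijenhuis_bracket (N' : M -> functional R M -> functional R M) X Y : M -> functional R M :=
  fun x => lie_bracket (tapp N' X) Y x + lie_bracket X (tapp N' Y) x - N' x (lie_bracket X Y x).

Lemma tangent_nijenhuis_bracket (V : set M) X Y x : open V -> V x ->
  vector_field V X -> vector_field V Y -> tangent x (nijenhuis_bracket N X Y x).
Proof.
move=> oV Vx VX VY.
have FX := vector_field_near oV Vx VX; have FY := vector_field_near oV Vx VY.
have FNX := field_near_anchored HU oV Vx VX; have FNY := field_near_anchored HU oV Vx VY.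
apply: tangent_add; first by apply: tangent_add; exact: tangent_lie_bracket.
by apply: tangent_opp; apply: (anchored_tangent HU); exact: tangent_lie_bracket.
Qed.

(** Near [u x] the right-invariant field of U X is the combination of the [B i] with coefficients
    X^i o t. The computation is then that of the torsion, the bracket of (TM)_N supplying the mixed
    terms. *)
Lemma bracket_defect c (V : set M) X Y x f : atlas c -> cdom c x -> open V -> V x ->
  vector_field V X -> vector_field V Y -> smooth_at (u x) f ->
  lie_bracket (ri (US X)) (ri (US Y)) (u x) f - U x (nijenhuis_bracket N X Y x) f =
  \sum_l \sum_j X x (coord c l) * Y x (coord c j) * curvature GM U c l j (u x) f.
Proof.
move=> ac cx oV Vx VX VY sf.
have FX := vector_field_near oV Vx VX; have FY := vector_field_near oV Vx VY.
have FNX := field_near_anchored HU oV Vx VX; have FNY := field_near_anchored HU oV Vx VY.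
have tNB := tangent_nijenhuis_bracket oV Vx VX VY.
have [tX tY] := (field_near_tangent FX, field_near_tangent FY).
have cu : cdom c (t (u x)) by rewrite tgt_unit.
have Vu : V (t (u x)) by rewrite tgt_unit.
have sX := section_near_image HU oV Vu VX; have sY := section_near_image HU oV Vu VY.
have FrX := field_near_right_invariant sX; have FrY := field_near_right_invariant sY.
pose B i := ri (US (dcoord c i)).
have FB i : field_near (u x) (B i) by exact: (field_near_dcoord_image HU).
have sc i := smooth_at_coord i ac cx.
pose al i y := X y (coord c i); pose be i y := Y y (coord c i).
have sal i : smooth_at x (al i) by have [_] := FX; exact.
have sbe i : smooth_at x (be i) by have [_] := FY; exact.
have tV Z : vector_field V Z -> \forall q \near u x, tangent (t q) (Z (t q)).
  move=> [tZ _]; apply: (@near_tgt _ _ _ _ _ _ _ (fun y => tangent y (Z y))); rewrite tgt_unit.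
  by apply/nbhs_openP; exists V.
have rE Z f' : vector_field V Z -> \forall q \near u x,
    ri (US Z) q f' = \sum_i (fun y => Z y (coord c i)) (t q) * B i q f'.
  move=> VZ; apply: filterS2 (tV Z VZ) (near_cdom_tgt cu) => q tq cq.
  by rewrite [ri _ q](right_invariant_expand HU ac cq tq) fct_sumE.
have scomp (n : M -> R) : smooth_at x n -> smooth_at (u x) (n \o t) by exact: smooth_at_comp_tgt.
have E1 := @bracket_expand _ _ _ _ (u x) (ri (US X)) (ri (US Y)) B (fun i => al i \o t)
  (fun i => be i \o t) f (field_near_tangent FrX) (field_near_tangent FrY) FB
  (fun i => scomp _ (sal i)) (fun i => scomp _ (sbe i)) sf
  (fun f' _ => rE X f' VX) (fun f' _ => rE Y f' VY).
pose n i j := anchor_coef GM U c j i.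
have sn i j : smooth_at x (n i j) by exact: (smooth_at_anchor_coef HU).
have E2 i := @anchor_coef_identity _ _ _ _ x (X x) (Y x) al be (n i)
  (fun l j => dcoord c l x (anchor_coef GM U c j i)) tX tY sal sbe (sn i)
  (fun j => tangent_expand ac cx tX (sn i j)) (fun j => tangent_expand ac cx tY (sn i j)).
rewrite lie_bracketE // E1 (U_expand HU ac cx tNB) fct_sumE.
have Bu i : B i (u x) = U x (dcoord c i x).
  by rewrite /B right_invariant_unit //; apply: (U_vertical HU); exact: tangent_dcoord.
have Nc Z i : vector_field V Z -> \forall y \near x,
    tapp N Z y (coord c i) = \sum_j Z y (coord c j) * n i j y.
  move=> [tZ _]; have nV : nbhs x V by exact: open_nbhs_nbhs.
  by apply: filterS2 nV (cdom_nbhs cx) => y Vy cy; apply: (anchored_coord HU) => //; exact: tZ.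
have rN Z (h : M -> R) : vector_field V Z -> smooth_at x h ->
    ri (US Z) (u x) (h \o t) = tapp N Z x h.
  move=> [tZ _] sh; rewrite right_invariant_unit; last by apply: (U_vertical HU); exact: tZ.
  by rewrite /tapp anchoredE.
have -> : \sum_l \sum_j X x (coord c l) * Y x (coord c j) * curvature GM U c l j (u x) f =
  \sum_l \sum_j al l x * be j x *
     (B l (u x) (fun q => B j q f) - B j (u x) (fun q => B l q f))
  - \sum_i \sum_l \sum_j al l x * be j x * (dcoord c l x (anchor_coef GM U c j i)
       - dcoord c j x (anchor_coef GM U c l i)) * B i (u x) f.
  rewrite [X in _ = _ - X]exchange_big -sumrB; apply: eq_bigr => l _ /=.
  rewrite [X in _ = _ - X]exchange_big -sumrB; apply: eq_bigr => j _ /=.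
  rewrite /curvature tgt_unit mulrBr mulr_sumr; congr (_ - _).
  by apply: eq_bigr => i _; rewrite !mulrA.
rewrite /= tgt_unit -addrA; congr (_ + _).
rewrite -sumrB -sumrN; apply: eq_bigr => i _.
have -> : \sum_l \sum_j al l x * be j x * (dcoord c l x (anchor_coef GM U c j i)
     - dcoord c j x (anchor_coef GM U c l i)) * B i (u x) f =
  (\sum_l \sum_j al l x * be j x * (dcoord c l x (anchor_coef GM U c j i)
     - dcoord c j x (anchor_coef GM U c l i))) * B i (u x) f.
  by rewrite mulr_suml; apply: eq_bigr => l _; rewrite mulr_suml.
(* Read backwards, [E2] reduces the claim to an equality between coefficients of [B i]. *)
rewrite -[RHS]mulNr -E2 Bu.
rewrite -[(_ *: U x (dcoord c i x)) f]/(nijenhuis_bracket N X Y x (coord c i) * U x (dcoord c i x) f).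
rewrite !rN // -mulrBl; congr (_ * _).
rewrite /nijenhuis_bracket.
rewrite -[(_ + _ - _) _]/(lie_bracket (tapp N X) Y x (coord c i) +
  lie_bracket X (tapp N Y) x (coord c i) - N x (lie_bracket X Y x) (coord c i)).
rewrite !lie_bracketE // (anchored_coord HU) //; last exact: tangent_lie_bracket.
have -> : \sum_j lie_bracket X Y x (coord c j) * anchor_coef GM U c j i x =
    \sum_j (X x (be j) - Y x (al j)) * n i j x.
  by apply: eq_bigr => j _; rewrite lie_bracketE.
rewrite (tangent_eq tY (Nc X i VX)) (tangent_eq tX (Nc Y i VY)) /al /be.
ring.
Qed.

End AlgebroidBrackets.

(** * Nijenhuis operators and right-invariant tensors *)

Lemma torsion_cancel (V : zmodType) (a b c : V) : - a + (b + c) + a - b - c = 0.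
Proof. by rewrite [- a + _ + _]addrAC addNr add0r [b + c]addrC addrK subrr. Qed.

Lemma sum_kronecker (R : realType) n (i j : 'I_n) (F : 'I_n -> 'I_n -> R) :
  \sum_l \sum_r (i == l)%:R * (j == r)%:R * F l r = F i j.
Proof.
rewrite (bigD1 i) //= (bigD1 j) //= !eqxx !mul1r.
rewrite big1 ?addr0 => [|r /negbTE rj]; last by rewrite [j == _]eq_sym rj mulr0 mul0r.
rewrite big1 ?addr0 // => l /negbTE li; rewrite big1 // => r _.
by rewrite [i == _]eq_sym li !mul0r.
Qed.

Section Correspondence.
Context {R : realType} {k m : nat} {G : manifold R k} {M : manifold R m}.
Variable GM : lie_groupoid G M.
Variable U : M -> functional R M -> functional R G.
Hypothesis HU : @bundle_map R m M (tangent_bundle M) (groupoid_bundle GM) U.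
Implicit Types (g h q : G) (x : M) (f e : G -> R) (c : chart R M m).
Local Notation s := (src GM).
Local Notation t := (tgt GM).
Local Notation u := (gunit GM).
Local Notation ri := (right_invariant GM).
Local Notation K := (right_tensor GM U).
Local Notation N := (anchored GM U).
Local Notation US := (image_section U).

Let ss : smooth_map s := proj1 (src_submersion GM).
Let st : smooth_map t := proj1 (tgt_submersion GM).
Let su : smooth_map u := gunit_smooth GM.

(** Right-invariant fields annihilate f o s on a neighbourhood of [g], so both iterated derivatives
    of f o s vanish. *)
Lemma vertical_bracket g a b : section_near GM (t g) a -> section_near GM (t g) b ->
  vertical GM g (lie_bracket (ri a) (ri b) g).
Proof.
move=> sa sb; have [Fa Fb] := (field_near_right_invariant sa, field_near_right_invariant sb).
have [ta tb] := (field_near_tangent Fa, field_near_tangent Fb).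
split; first exact: tangent_lie_bracket.
have E a' (f : M -> R) : section_near GM (t g) a' -> smooth_at (s g) f ->
    \forall q \near g, ri a' q (f \o s) = cst 0 q.
  move=> [va _] sf; have [cs _] := ss; have sfn : \forall q \near g, smooth_at (s q) f.
    exact: cs (smooth_at_near sf).
  apply: filterS2 (near_tgt va) sfn => q vq sq.
  by have [_ /(congr1 (@^~ f))] := right_invariant_vertical vq; rewrite /= dmapE.
apply/funext => f; rewrite /dmap; case: asboolP => // sf.
rewrite lie_bracketE; last exact: smooth_at_smooth_map ss sf.
by rewrite (tangent_eq ta (E b f sb sf)) (tangent_eq tb (E a f sa sf)) (tangent_cst 0 ta) (tangent_cst 0 tb) subr0.
Qed.

(** The right-invariant field of U X is [t]-related to N X, and brackets of related fields are
    related. *)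
Lemma dmap_tgt_bracket (V : set M) X Y x : open V -> V x ->
  vector_field V X -> vector_field V Y ->
  dmap t (u x) (lie_bracket (ri (US X)) (ri (US Y)) (u x)) =
  lie_bracket (tapp N X) (tapp N Y) x.
Proof.
move=> oV Vx VX VY.
have Vu : V (t (u x)) by rewrite tgt_unit.
have FNX := field_near_anchored HU oV Vx VX; have FNY := field_near_anchored HU oV Vx VY.
have E Z (f : M -> R) q : vector_field V Z -> V (t q) -> smooth_at (t q) f ->
    ri (US Z) q (f \o t) = tapp N Z (t q) f.
  move=> [tZ _] Vq sf; rewrite -(@dmapE _ _ _ _ _ t q (ri (US Z) q) f sf).
  by rewrite dmap_tgt_right_invariant //; apply: (U_vertical HU); exact: tZ.
have nE Z (f : M -> R) : vector_field V Z -> smooth_at x f ->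
    \forall q \near u x, ri (US Z) q (f \o t) = ((fun y => tapp N Z y f) \o t) q.
  move=> VZ sf.
  have : \forall q \near u x, V (t q) /\ smooth_at (t q) f.
    apply: (@near_tgt _ _ _ _ _ _ _ (fun y => V y /\ smooth_at y f)); rewrite tgt_unit.
    by apply: filterI (smooth_at_near sf); exact: open_nbhs_nbhs.
  by apply: filterS => q [Vq sq]; exact: E.
have sX := section_near_image HU oV Vu VX; have sY := section_near_image HU oV Vu VY.
have tX := field_near_tangent (field_near_right_invariant sX).
have tY := field_near_tangent (field_near_right_invariant sY).
apply/funext => f; rewrite /dmap tgt_unit [RHS]/lie_bracket; case: asboolP => // sf.
rewrite lie_bracketE; last exact: smooth_at_comp_tgt.
rewrite (tangent_eq tX (nE Y f VY sf)) (tangent_eq tY (nE X f VX sf)).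
by rewrite !E ?tgt_unit //; [have [_] := FNX|have [_] := FNY]; apply.
Qed.

Lemma tangent_torsion g X Y : field_near g X -> field_near g Y -> tangent g (torsion K X Y g).
Proof.
move=> FX FY.
have FKX := field_near_right_tensor HU FX; have FKY := field_near_right_tensor HU FY.
have tK v : tangent g v -> tangent g (K g v) by exact: (tangent_right_tensor HU).
apply: tangent_add; last by apply/tangent_opp/tK/tangent_lie_bracket.
apply: tangent_add; last by apply/tangent_opp/tK/tangent_lie_bracket.
by apply: tangent_add; [exact: tangent_lie_bracket|apply/tK/tK/tangent_lie_bracket].
Qed.

Lemma torsion_eq0 g X Y : field_near g X -> field_near g Y ->
  fn_bracket K K X Y g = 0 -> torsion K X Y g = 0.
Proof.
move=> FX FY; rewrite (fn_bracketE HU FX FY) => T0; apply/funext => f.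
have : (torsion K X Y g + torsion K X Y g) f = 0 by rewrite T0.
rewrite -[X in X = _]/(torsion K X Y g f + torsion K X Y g f).
by rewrite -mulr2n => /eqP; rewrite mulrn_eq0 => /eqP.
Qed.

Definition flat_at_unit x : Prop := forall c l j f, atlas c -> cdom c x ->
  smooth_at (u x) f -> curvature GM U c l j (u x) f = 0.

Lemma flat_fn_bracket_eq0 : (forall x, flat_at_unit x) -> fn_bracket_eq0 K K.
Proof.
move=> flat V X Y oV VX VY g Vg.
have FX := vector_field_near oV Vg VX; have FY := vector_field_near oV Vg VY.
rewrite (fn_bracketE HU FX FY) (_ : torsion K X Y g = 0) ?addr0 //.
apply: (@tangent_ext _ _ _ g); [exact: tangent_torsion|exact: tangent0|].
move=> f sf; have [c ac cg] := atlas_cover (t g).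
rewrite (torsion_expand HU ac cg FX FY sf).
have [e se E] := curvature_right_invariant HU ac cg sf.
by rewrite big1 // => l _; rewrite big1 // => j _; rewrite E flat // mulr0.
Qed.

Lemma fn_bracket_eq0_flat : fn_bracket_eq0 K K -> forall x, flat_at_unit x.
Proof.
move=> fn0 x c l j f ac cx sf; have [d ad du] := atlas_cover (u x).
have cu : cdom c (t (u x)) by rewrite tgt_unit.
have [_ surj] := tgt_submersion GM.
(* [a] is the coordinate vector, in a chart of G, of a lift of d_i through the differential of [t]
   at [u x]. *)
have lift i : exists a, forall i', chart_derivation d (u x) a (coord c i' \o t) = (i == i')%:R.
  have [v tv vE] := surj (u x) _ (tangent_dcoord i ac cu).
  exists (\row_i0 v (coord d i0)) => i'; rewrite -(tangent_chart ad du tv).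
  have sc := smooth_at_coord i' ac cu.
  by rewrite -(dcoord_coord i i' ac cu) -vE dmapE.
have [al alE] := lift l; have [be beE] := lift j.
pose X q := chart_derivation d q al; pose Y q := chart_derivation d q be.
have FX q : cdom d q -> field_near q X by exact: field_near_chart_derivation.
have FY q : cdom d q -> field_near q Y by exact: field_near_chart_derivation.
have od := cdom_open d.
have VX : vector_field (cdom d) X by apply/vector_fieldP.
have VY : vector_field (cdom d) Y by apply/vector_fieldP.
have T0 := torsion_eq0 (FX _ du) (FY _ du) (fn0 _ X Y od VX VY (u x) du).
have := torsion_expand HU ac cu (FX _ du) (FY _ du) sf; rewrite T0.
move=> E; rewrite -(sum_kronecker l j (fun l' j' => curvature GM U c l' j' (u x) f)).
apply: (etrans _ (esym E)).
by apply: eq_bigr => l' _; apply: eq_bigr => j' _; rewrite -alE -beE.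
Qed.

Lemma flat_bracket (V : set M) X Y x : flat_at_unit x -> open V -> V x ->
  vector_field V X -> vector_field V Y ->
  lie_bracket (ri (US X)) (ri (US Y)) (u x) = U x (nijenhuis_bracket N X Y x).
Proof.
move=> flat oV Vx VX VY; have Vu : V (t (u x)) by rewrite tgt_unit.
have sX := section_near_image HU oV Vu VX; have sY := section_near_image HU oV Vu VY.
have [tb _] := vertical_bracket sX sY.
have [tU _] := U_vertical HU (tangent_nijenhuis_bracket HU oV Vx VX VY).
apply: (tangent_ext tb tU) => f sf; apply/eqP; rewrite -subr_eq0.
have [c ac cx] := atlas_cover x; rewrite (bracket_defect HU ac cx oV Vx VX VY sf).
by rewrite big1 // => l _; rewrite big1 // => j _; rewrite flat // mulr0.
Qed.

Lemma bracket_flat x : (forall c l j, atlas c -> cdom c x ->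
   lie_bracket (ri (US (dcoord c l))) (ri (US (dcoord c j))) (u x) =
   U x (nijenhuis_bracket N (dcoord c l) (dcoord c j) x)) -> flat_at_unit x.
Proof.
move=> B0 c l j f ac cx sf; have od := cdom_open c.
have := bracket_defect HU ac cx od cx (vector_field_dcoord l ac) (vector_field_dcoord j ac) sf.
rewrite B0 // subrr.
(* The coordinate fields have Kronecker components, which single out the (l, j) term of the sum. *)
move=> E; rewrite -(sum_kronecker l j (fun l' j' => curvature GM U c l' j' (u x) f)).
apply: (etrans _ (esym E)).
apply: eq_bigr => l' _; apply: eq_bigr => j' _.
by rewrite -(dcoord_coord l l' ac cx) -(dcoord_coord j j' ac cx).
Qed.

(** The components [b] of X satisfy a linear system: [b *m A] is the row of components of U X, the
    rows of [A] being those of the U d_i. Injectivity of U at [x] makes [A] row free there, so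
    [smooth_at_solve] applies. *)
Lemma smooth_at_preimage (V : set M) X x :
  (forall v, tangent x v -> U x v = 0 -> v = 0) ->
  open V -> V x -> (forall y, V y -> tangent y (X y)) ->
  (forall e, smooth_at (u x) e -> smooth_at x (fun y => US X y e)) ->
  forall h : M -> R, smooth_at x h -> smooth_at x (fun y => X y h).
Proof.
move=> injU oV Vx tX sUX h sh.
have [c ac cx] := atlas_cover x; have [d ad du] := atlas_cover (u x).
have nV : \forall y \near x, V y /\ cdom c y.
  by apply: filterI (cdom_nbhs cx); exact: open_nbhs_nbhs.
pose A y : 'M[R]_(m, k) := \matrix_(i, j) U y (dcoord c i y) (coord d j).
pose b y : 'rV[R]_m := \row_i X y (coord c i).
have sb i : smooth_at x (fun y => X y (coord c i)).
  have -> : (fun y => X y (coord c i)) = (fun y => b y 0 i) by apply/funext => y; rewrite mxE.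
  apply: (@smooth_at_solve _ _ _ m k x A b) => [i' j|v vA|j].
  - have -> : (fun y => A y i' j) = (fun y => US (dcoord c i') y (coord d j)).
      by apply/funext => y; rewrite mxE.
    by have [_] := section_near_dcoord HU i' ac cx; apply; exact: smooth_at_coord.
  - pose w := \sum_i' v 0 i' *: dcoord c i' x.
    have tw : tangent x w.
      rewrite /w; elim/big_ind: _ => [|w1 w2|i' _]; [exact: tangent0|exact: tangent_add|].
      by apply: tangentZ; exact: tangent_dcoord.
    have [tUw _] := U_vertical HU tw.
    have w0 : w = 0.
      apply: injU => //; rewrite (tangent_dcoordE ad du tUw) big1 // => j _.
      have -> : U x w (coord d j) = (v *m A x) 0 j.
        rewrite /w (U_sum HU) => [|i']; last exact: tangent_dcoord.
        by rewrite fct_sumE mxE; apply: eq_bigr => i' _; rewrite mxE.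
      by rewrite vA mxE scale0r.
    apply/rowP => i'; rewrite mxE; have := congr1 (@^~ (coord c i')) w0.
    rewrite /w fct_sumE (bigD1 i') //= big1 ?addr0.
      rewrite -[X in X = _ -> _]/(v 0 i' * dcoord c i' x (coord c i')).
      by rewrite dcoord_coord // eqxx mulr1.
    move=> i0 /negbTE ne; rewrite -[LHS]/(v 0 i0 * dcoord c i0 x (coord c i')).
    by rewrite dcoord_coord // ne mulr0.
  - apply: (@smooth_at_eq _ _ _ _ (fun y => US X y (coord d j))).
      apply: filterS nV => y [Vy cy].
      rewrite mxE /image_section (U_expand HU ac cy (tX _ Vy)) fct_sumE.
      by apply: eq_bigr => i' _; rewrite !mxE.
    by apply: sUX; exact: smooth_at_coord.
apply: (@smooth_at_eq _ _ _ _ (fun y => \sum_i X y (coord c i) * dcoord c i y h)).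
  apply: filterS2 nV (smooth_at_near sh) => y [Vy cy] sy.
  by rewrite -tangent_expand //; exact: tX.
by apply: smooth_at_sum => i; apply: smooth_atM => //; exact: smooth_at_chart_derivation.
Qed.

Lemma tensor11_anchored : tensor11 N.
Proof.
split=> [x v|x a v w|V X oV VX].
- exact: (anchored_tangent HU).
- exact: (anchored_lin HU).
- by apply/vector_fieldP => // x Vx; exact: (field_near_anchored HU oV Vx VX).
Qed.

Lemma nijenhuis_anchored : (forall x, flat_at_unit x) -> nijenhuis N.
Proof.
move=> flat; split; first exact: tensor11_anchored.
move=> V X Y oV VX VY x Vx.
have FX := vector_field_near oV Vx VX; have FY := vector_field_near oV Vx VY.
have FNX := field_near_anchored HU oV Vx VX; have FNY := field_near_anchored HU oV Vx VY.
have tXY := tangent_lie_bracket FX FY.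
have [tNXY tXNY] := (tangent_lie_bracket FNX FY, tangent_lie_bracket FX FNY).
have tNb : tangent x (N x (lie_bracket X Y x)) by exact: (anchored_tangent HU).
(* This turns [N X, N Y] into N [X, Y]_N; expanding by linearity leaves a sum that cancels. *)
rewrite /torsion -(dmap_tgt_bracket oV Vx VX VY) (flat_bracket (flat x) oV Vx VX VY).
rewrite -/(N x _) /nijenhuis_bracket.
have -> : lie_bracket (tapp N X) Y x + lie_bracket X (tapp N Y) x - N x (lie_bracket X Y x) =
   (-1) *: N x (lie_bracket X Y x) + (1 *: lie_bracket (tapp N X) Y x + lie_bracket X (tapp N Y) x).
  by rewrite scaleN1r scale1r addrC.
rewrite !(anchored_lin HU) //; last by apply: tangent_lin.
rewrite scaleN1r scale1r.
exact: torsion_cancel.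
Qed.

End Correspondence.

(** * From algebroid isomorphisms to bundle maps and back *)

Section Inverse.
Context {R : realType} {k m : nat} {G : manifold R k} {M : manifold R m}.
Variable GM : lie_groupoid G M.
Implicit Types (g h q : G) (x : M).
Local Notation s := (src GM).
Local Notation t := (tgt GM).
Local Notation u := (gunit GM).

(** Allows for fields that coincide only near [x], and for operators known to agree only on tangent
    vectors. *)
Lemma nijenhuis_bracket_near (N N' : M -> functional R M -> functional R M) X Y X' Y' x :
  tangent x (X x) -> tangent x (Y x) -> tangent x (N x (X x)) -> tangent x (N x (Y x)) ->
  (\forall y \near x, X y = X' y) -> (\forall y \near x, Y y = Y' y) ->
  (\forall y \near x, N y (X y) = N' y (X' y)) -> (\forall y \near x, N y (Y y) = N' y (Y' y)) ->
  N x (lie_bracket X Y x) = N' x (lie_bracket X Y x) ->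
  nijenhuis_bracket N X Y x = nijenhuis_bracket N' X' Y' x.
Proof.
move=> tX tY tNX tNY XX YY NX NY NXY; rewrite /nijenhuis_bracket NXY.
rewrite (lie_bracket_near tX tY XX YY) (lie_bracket_near (X := tapp N X) tNX tY NX YY).
by rewrite (lie_bracket_near (Y := tapp N Y) tX tNY XX NY).
Qed.

Lemma integrates_right_tensor (N : M -> functional R M -> functional R M) :
  nijenhuis N -> integrates GM N ->
  exists U : M -> functional R M -> functional R G,
      [/\ @bundle_map R m M (tangent_bundle M) (groupoid_bundle GM) U,
          forall g v, tangent g v ->
            (right_tensor GM U g v = 0 <-> dmap t g v = 0),
          forall g w,
            (exists2 v, tangent g v & right_tensor GM U g v = w) <->
            (tangent g w /\ dmap s g w = 0)
        & fn_bracket_eq0 (right_tensor GM U) (right_tensor GM U)].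
Proof.
move=> [tN _] [F [[[F1 F2 F3] [U [HU UF FU]]] anc br]].
rewrite /= in U HU UF FU anc br F1 F2 F3.
have st : smooth_map t := proj1 (tgt_submersion GM).
(* [F] respects anchors, so the anchor of A composed with the inverse of [F] is the given
   operator. *)
have NE x v : tangent x v -> anchored GM U x v = N x v.
  by move=> tv; have := anc x (U x v) (U_vertical HU tv); rewrite FU.
exists U; split=> //.
- move=> g v tv; have tdv := dmap_tangent st tv.
  split=> [K0|dv0]; last by rewrite /right_tensor dv0 (U0 HU) dright0.
  have vU := U_vertical HU tdv.
  (* Right translation is injective on vertical vectors; afterwards [F] is a left inverse of [U]. *)
  have U0' : U (t g) (dmap t g v) = 0.
    have v0 : vertical GM (u (t g)) 0 by rewrite -(U0 HU (t g)); exact: (U_vertical HU (tangent0 _)).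
    by apply: (dright_inj vU v0); rewrite dright0.
  by rewrite -(FU _ _ tdv) U0' -[in LHS](U0 HU (t g)) FU //; exact: tangent0.
- move=> g w; split=> [[v tv <-]|vw].
    have := dright_vertical (U_vertical HU (dmap_tangent st tv)) (src_unit_tgt GM g).
    by rewrite mul_unit_tgt.
  (* [w] is translated back to the unit, sent to TM by [F], and the result is lifted through the
     submersion [t]. *)
  have [v vv <-] := dright_surj vw.
  have [v' tv' v'E] := (proj2 (tgt_submersion GM)) g _ (F1 _ _ vv).
  by exists v' => //; rewrite /right_tensor v'E UF.
(* Flatness involves coordinate fields only, so the brackets are compared on the sections U d_l and
   U d_j. *)
apply: (flat_fn_bracket_eq0 HU) => x.
apply: (bracket_flat HU) => c l j ac cx.
have oc := cdom_open c.
have [Vl Vj] := (vector_field_dcoord l ac, vector_field_dcoord j ac).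
have [_ _ HU3] := HU.
have sl := HU3 _ _ oc Vl; have sj := HU3 _ _ oc Vj.
have nc : \forall y \near x, cdom c y by exact: cdom_nbhs.
have cu : cdom c (t (u x)) by rewrite tgt_unit.
have := vertical_bracket (section_near_dcoord HU l ac cu) (section_near_dcoord HU j ac cu).
move=> vb; rewrite -[LHS](UF x) //; congr (U x _).
rewrite (br _ _ _ oc sl sj x cx) -[LHS]/(nijenhuis_bracket N _ _ x).
have tl y i : cdom c y -> tangent y (dcoord c i y) by exact: tangent_dcoord.
have tA y i : cdom c y -> tangent y (anchored GM U y (dcoord c i y)).
  by move=> cy; apply: (anchored_tangent HU); exact: tl.
apply/esym; apply: nijenhuis_bracket_near; try (by auto).
- by apply: filterS nc => y cy; rewrite /image_section FU //; exact: tl.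
- by apply: filterS nc => y cy; rewrite /image_section FU //; exact: tl.
- by apply: filterS nc => y cy; rewrite /image_section FU ?NE //; exact: tl.
- by apply: filterS nc => y cy; rewrite /image_section FU ?NE //; exact: tl.
- by rewrite NE //; apply: tangent_lie_bracket; exact: field_near_dcoord.
Qed.

Lemma right_tensor_integrates (U : M -> functional R M -> functional R G) :
  @bundle_map R m M (tangent_bundle M) (groupoid_bundle GM) U ->
  (forall g v, tangent g v -> (right_tensor GM U g v = 0 <-> dmap t g v = 0)) ->
  (forall g w, (exists2 v, tangent g v & right_tensor GM U g v = w) <->
     (tangent g w /\ dmap s g w = 0)) ->
  fn_bracket_eq0 (right_tensor GM U) (right_tensor GM U) ->
  nijenhuis (anchored GM U) /\ integrates GM (anchored GM U).
Proof.
move=> HU kerU imU fn0; have flat := fn_bracket_eq0_flat HU fn0.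
split; first exact: (nijenhuis_anchored HU).
have su : smooth_map u := gunit_smooth GM.
have st : smooth_map t := proj1 (tgt_submersion GM).
(* At a unit no translation remains, so the kernel and image conditions there say that [U x] is a
   bijection onto the vertical vectors. *)
have KE x v : tangent (u x) v -> right_tensor GM U (u x) v = U x (dmap t (u x) v).
  move=> tv; have td : tangent x (dmap t (u x) v).
    by have := dmap_tangent st tv; rewrite tgt_unit.
  rewrite /right_tensor tgt_unit.
  by have := dright_unit (U_vertical HU td); rewrite src_unit.
have injU x v : tangent x v -> U x v = 0 -> v = 0.
  move=> tv Uv0; have tv' : tangent (t (u x)) v by rewrite tgt_unit.
  have [w tw wE] := (proj2 (tgt_submersion GM)) (u x) v tv'.
  by rewrite -wE; apply/(kerU _ _ tw); rewrite KE // wE.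
have surjU x a : vertical GM (u x) a -> exists v, tangent x v /\ U x v = a.
  move=> va; have [v tv vE] := (imU (u x) a).2 va.
  exists (dmap t (u x) v); split; last by rewrite -KE.
  by have := dmap_tangent st tv; rewrite tgt_unit.
(* The pointwise inverse of U. On vertical vectors a preimage exists, so the default 0 does not
   occur. *)
pose F x (a : functional R G) := xget 0 [set v | tangent x v /\ U x v = a].
have FP x a : vertical GM (u x) a -> tangent x (F x a) /\ U x (F x a) = a.
  by move=> /surjU va; have := xgetPex 0 va.
have injU2 x v w : tangent x v -> tangent x w -> U x v = U x w -> v = w.
  move=> tv tw vw; apply/eqP; rewrite -subr_eq0; apply/eqP.
  have tvw : tangent x (v - w) by apply: tangent_add => //; exact: tangent_opp.
  apply: (injU x) => //; rewrite -scaleN1r addrC (U_lin HU) // vw.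
  by rewrite scaleN1r addNr.
have FU x v : tangent x v -> F x (U x v) = v.
  move=> tv; have [tF FE] := FP x _ (U_vertical HU tv).
  exact: injU2 FE.
have Flin x (a : R) v w : vertical GM (u x) v -> vertical GM (u x) w ->
    F x (a *: v + w) = a *: F x v + F x w.
  move=> vv vw; have [[tv vE] [tw wE]] := (FP _ _ vv, FP _ _ vw).
  have [tF FE] := FP _ _ (vertical_lin a vv vw).
  by apply: (injU2 x) => //; [exact: tangent_lin|rewrite FE (U_lin HU) // vE wE].
(* A section [a] is U applied to its image under [F], so smoothness passes to that image by
   [smooth_at_preimage]. *)
have Fsec (V : set M) a : open V -> bsection (groupoid_bundle GM) V a ->
    vector_field V (fun x => F x (a x)).
  move=> oV [sa a0]; have [cu _] := su.
  have [ta _] := sa; have va x : V x -> vertical GM (u x) (a x).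
    by move=> Vx; split; [exact: ta|exact: a0].
  apply/(smooth_alongP _ (fun x A nA => nA) oV) => x Vx.
  have [tFx _] := FP _ _ (va x Vx); split=> // f sf.
  apply: (@smooth_at_preimage _ _ _ _ _ GM U HU V (fun y => F y (a y)) x) => //.
  - by move=> v; exact: injU.
  - by move=> y Vy; have [] := FP _ _ (va y Vy).
  - move=> e se; have := (smooth_alongP a cu oV).1 sa x Vx => -[_ /(_ e se)].
    apply: smooth_at_eq; have nV : nbhs x V by exact: open_nbhs_nbhs.
    by apply: filterS nV => y Vy; rewrite /image_section; have [_ ->] := FP _ _ (va y Vy).
exists F; split.
- split; first by split=> // x v /FP[].
  by exists U; split=> // x v /FP[].
- by move=> x v vv; have [_ FE] := FP _ _ vv; rewrite /= /anchored FE.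
move=> V a b oV sa sb x Vx.
have [Fa Fb] := (Fsec V a oV sa, Fsec V b oV sb).
have UF y c : V y -> bsection (groupoid_bundle GM) V c -> U y (F y (c y)) = c y.
  move=> Vy [[tc _] c0]; have vc : vertical GM (u y) (c y) by split; [exact: tc|exact: c0].
  by have [] := FP _ _ vc.
have tNB := tangent_nijenhuis_bracket HU oV Vx Fa Fb.
(* Once the right-hand side is written as a value of [F x], it remains to compare two brackets in A,
   where flatness applies. *)
rewrite -[RHS](FU x) //; congr (F x _).
rewrite -[RHS](flat_bracket HU (flat x) oV Vx Fa Fb) /=.
have Vu : V (t (u x)) by rewrite tgt_unit.
have sFa := field_near_tangent (field_near_right_invariant (section_near_image HU oV Vu Fa)).
have sFb := field_near_tangent (field_near_right_invariant (section_near_image HU oV Vu Fb)).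
(* [a] and U o F o a agree only over [V], so their right-invariant fields agree only at the points
   whose target is in [V]; these form a neighbourhood of [u x]. *)
have nV : \forall q \near u x, V (t q).
  by apply: (@near_tgt _ _ _ _ _ GM (u x) V); apply: open_nbhs_nbhs.
apply/esym; apply: lie_bracket_near => //.
- by apply: filterS nV => q Vq; rewrite /right_invariant /image_section UF.
- by apply: filterS nV => q Vq; rewrite /right_invariant /image_section UF.
Qed.

End Inverse.

Theorem theorem1p2 (R : realType) (k m : nat) (G : manifold R k)
    (M : manifold R m) (GM : lie_groupoid G M) :
  (exists N : M -> functional R M -> functional R M,
      nijenhuis N /\ integrates GM N)
  <->
  (exists U : M -> functional R M -> functional R G,
      [/\ @bundle_map R m M (tangent_bundle M) (groupoid_bundle GM) U,
          forall g v, tangent g v ->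
            (right_tensor GM U g v = 0 <-> dmap (tgt GM) g v = 0),
          forall g w,
            (exists2 v, tangent g v & right_tensor GM U g v = w) <->
            (tangent g w /\ dmap (src GM) g w = 0)
        & fn_bracket_eq0 (right_tensor GM U) (right_tensor GM U)]).
Proof.
split=> [[N [nN iN]]|[U [HU kerU imU fn0]]]; first exact: integrates_right_tensor iN.
by exists (anchored GM U); exact: right_tensor_integrates.
Qed.
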